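(* There exist absolute constants $C_3,C_4>0$ such that for every $n\ge 3$, the group $\mathrm{SL}_n(\mathbb Z)$ admits a finite presentation on two generators with at most $C_3n^4$ defining relators and total relator length at most $C_4n^6$.
   Context: The total relator length of a presentation on generators $a,b$ is the sum of the lengths of its relators, measured in the free group on $\{a,b\}$ (freely reduced word length), where each relation $U=V$ is interpreted as the relator $UV^{-1}$. *)

(* Defs.v *)
From HB Require Import structures.
From mathcomp Require Import all_boot all_order all_algebra.
From mathcomp Require Import reals.

Set Implicit Arguments.
Unset Strict Implicit.
Unset Printing Implicit Defensive.

Import Order.TTheory GRing.Theory Num.Theory.

(* MathComp has no free groups: the elements of the free group on X are taken
   to be the freely reduced words in the letters X * bool, where (x, false)
   stands for x and (x, true) for x^-1. *)
Section FreeGroup.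
Variable X : choiceType.
Implicit Types (l m : X * bool) (u v w : seq (X * bool)).

Definition invl l : X * bool := (l.1, ~~ l.2).

Definition reduced w := sorted (fun l m => m != invl l) w.

Definition consr l w :=
  if w is m :: w' then if m == invl l then w' else l :: w else [:: l].

Definition reduce w := foldr consr [::] w.

Definition invw w := rev (map invl w).

Lemma invlK : involutive invl.
Proof. by case=> x b; rewrite /invl /= negbK. Qed.

Lemma consr_reduced l w : reduced w -> reduced (consr l w).
Proof.
case: w => [|m w] //= rw.
case: ifP => [_|/negbT ml]; first exact: path_sorted rw.
by rewrite /reduced /= ml.
Qed.

Lemma foldr_reduced u w : reduced w -> reduced (foldr consr w u).
Proof. by move=> rw; elim: u => //= l u; apply: consr_reduced. Qed.

Lemma reduceP w : reduced (reduce w).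
Proof. exact: foldr_reduced. Qed.

Lemma consrK l w : reduced w -> consr (invl l) (consr l w) = w.
Proof.
case: w => [|m w] /=; first by rewrite invlK eqxx.
case: eqP => [->|_]; last by rewrite /= invlK eqxx.
by case: w => [|k w] //= /andP[/negPf->].
Qed.

Lemma consrVK l w : reduced w -> consr l (consr (invl l) w) = w.
Proof. by move=> rw; rewrite -{1}[l]invlK consrK. Qed.

Lemma reduce_id w : reduced w -> reduce w = w.
Proof.
elim: w => //= l w IHw rw; rewrite IHw; last exact: path_sorted rw.
by case: w rw {IHw} => //= m w /andP[/negPf->].
Qed.

Lemma foldr_consr l u w : reduced w ->
  foldr consr w (consr l u) = consr l (foldr consr w u).
Proof.
move=> rw; case: u => //= m u; case: eqP => [->|//].
by rewrite consrVK// foldr_reduced.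
Qed.

Lemma foldr_reduce u w : reduced w ->
  foldr consr w (reduce u) = foldr consr w u.
Proof. by move=> rw; elim: u => //= l u <-; rewrite foldr_consr. Qed.

Lemma reduce_cat u v : reduce (u ++ v) = foldr consr (reduce v) u.
Proof. exact: foldr_cat. Qed.

Lemma foldr_invw u w : reduced w -> foldr consr (foldr consr w u) (invw u) = w.
Proof.
move=> rw; elim: u => //= l u IHu.
by rewrite /invw /= rev_cons -cats1 foldr_cat /= consrK ?foldr_reduced.
Qed.

Record freeGroup := FreeGroup {
  fgword : seq (X * bool);
  fgwordP : reduced fgword }.

HB.instance Definition _ := [isSub for fgword].
HB.instance Definition _ := [Choice of freeGroup by <:].

Implicit Types a b c : freeGroup.

Definition fg_one := @FreeGroup [::] isT.
Definition fg_mul a b := FreeGroup (reduceP (fgword a ++ fgword b)).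
(* The word invw (fgword a) is already reduced, so that reduce only serves to
   produce the proof of reducedness. *)
Definition fg_inv a := FreeGroup (reduceP (invw (fgword a))).

Lemma fg_mulA : associative fg_mul.
Proof.
move=> [u ru] [v rv] [w rw]; apply: val_inj => /=.
rewrite [RHS]reduce_cat foldr_reduce ?reduceP// -reduce_cat -catA.
by rewrite [LHS]reduce_cat (reduce_id (reduceP _)) -reduce_cat.
Qed.

Lemma fg_mul1g : left_id fg_one fg_mul.
Proof. by move=> [u ru]; apply: val_inj; apply: reduce_id. Qed.

Lemma fg_mulg1 : right_id fg_one fg_mul.
Proof. by move=> [u ru]; apply: val_inj; rewrite /= cats0 reduce_id. Qed.

Lemma fg_mulVg : left_inverse fg_one fg_inv fg_mul.
Proof.
move=> [u ru]; apply: val_inj => /=; rewrite reduce_cat foldr_reduce ?reduceP//.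
exact: (@foldr_invw u [::]).
Qed.

Lemma fg_mulgV : right_inverse fg_one fg_inv fg_mul.
Proof.
move=> a; rewrite -[LHS]fg_mul1g -{1}(fg_mulVg (fg_inv a)) -fg_mulA.
by rewrite [fg_mul (fg_inv a) _]fg_mulA fg_mulVg fg_mul1g fg_mulVg.
Qed.

HB.instance Definition _ :=
  isGroup.Build freeGroup fg_mulA fg_mul1g fg_mulg1 fg_mulVg fg_mulgV.

Definition fglen a : nat := size (fgword a).

End FreeGroup.

Section Presentation.
Local Open Scope group_scope.

Definition normal_subgroup (G : groupType) (N : G -> Prop) : Prop :=
  [/\ N 1, forall x y, N x -> N y -> N (x * y), forall x, N x -> N x^-1
    & forall x y, N x -> N (x ^ y)].

Definition normal_closure (G : groupType) (S : seq G) (g : G) : Prop :=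
  forall N : G -> Prop,
    normal_subgroup N -> (forall s, s \in S -> N s) -> N g.

(* <X | rels> presents G through f: the homomorphism f induces an isomorphism
   from the quotient of the free group by the normal closure of rels onto G. *)
Definition presents (X : choiceType) (rels : seq (freeGroup X)) (G : groupType)
    (f : {multiplicative freeGroup X -> G}) : Prop :=
  (forall g, exists w, f w = g) /\
  (forall w, f w = 1 <-> normal_closure rels w).

Definition has_presentation (X : choiceType) (rels : seq (freeGroup X))
    (G : groupType) : Prop :=
  exists f : {multiplicative freeGroup X -> G}, presents rels f.

Definition total_relator_length (X : choiceType) (rels : seq (freeGroup X)) :
    nat :=
  (\sum_(r <- rels) fglen r)%N.

End Presentation.

Section SpecialLinear.
Local Open Scope ring_scope.
Variables (n : nat) (R : comNzRingType).

Record SL := MkSL {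
  SLmx : 'M[R]_n;
  SLmxP : \det SLmx == 1 }.

HB.instance Definition _ := [isSub for SLmx].
HB.instance Definition _ := [Choice of SL by <:].

Implicit Types A B : SL.

Lemma SL_det A : \det (SLmx A) = 1.
Proof. exact/eqP/SLmxP. Qed.

Fact SL_one_subproof : \det (1%:M : 'M[R]_n) == 1.
Proof. by rewrite det1. Qed.

Fact SL_mul_subproof A B : \det (SLmx A *m SLmx B) == 1.
Proof. by rewrite det_mulmx !SL_det mulr1. Qed.

Fact SL_inv_subproof A : \det (\adj (SLmx A)) == 1.
Proof.
have := congr1 determinant (mul_mx_adj (SLmx A)).
by rewrite det_mulmx SL_det mul1r det1 => ->.
Qed.

Definition SL_one := MkSL SL_one_subproof.
Definition SL_mul A B := MkSL (SL_mul_subproof A B).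
(* The adjugate is the inverse of a matrix of determinant 1. *)
Definition SL_inv A := MkSL (SL_inv_subproof A).

Lemma SL_mulA : associative SL_mul.
Proof. by move=> A B C; apply: val_inj; apply: mulmxA. Qed.

Lemma SL_mul1g : left_id SL_one SL_mul.
Proof. by move=> A; apply: val_inj; apply: mul1mx. Qed.

Lemma SL_mulg1 : right_id SL_one SL_mul.
Proof. by move=> A; apply: val_inj; apply: mulmx1. Qed.

Lemma SL_mulVg : left_inverse SL_one SL_inv SL_mul.
Proof. by move=> A; apply: val_inj; rewrite /= mul_adj_mx SL_det. Qed.

Lemma SL_mulgV : right_inverse SL_one SL_inv SL_mul.
Proof. by move=> A; apply: val_inj; rewrite /= mul_mx_adj SL_det. Qed.

HB.instance Definition _ :=
  isGroup.Build SL SL_mulA SL_mul1g SL_mulg1 SL_mulVg SL_mulgV.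

End SpecialLinear.

(* Main.v *)
Require Import Defs.
From HB Require Import structures.
From mathcomp Require Import all_boot all_order all_algebra.
From mathcomp Require Import perm generic_quotient.
From mathcomp Require Import boolp reals.
From mathcomp Require Import zify ring.

Set Implicit Arguments.
Unset Strict Implicit.
Unset Printing Implicit Defensive.

Import Order.TTheory GRing.Theory Num.Theory.
Local Open Scope group_scope.

(** Write e_ij for the elementary matrices. They satisfy the relations
    collected in [steinberg]: e_ij and e_kl commute if j != k and i != l, the
    commutator of e_ij and e_jk is e_ik, and in each pair of coordinates the
    element w_ij = e_ij e_ji^-1 e_ij satisfies a braid relation and w_ij^4 = 1.
    These are O(n^4) relations of bounded length, and the heart of the matter
    is that they define SL_n(Z): if elements x_ij of a group K satisfy them and
    lie over the e_ij under a morphism from K to SL_n(Z), then this morphism is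
    injective on the subgroup generated by the x_ij ([gamma_itv_inj]).

    This follows by induction on n once the following is known ([chain_stab]):
    an element g of this subgroup whose image fixes the basis vector e_r is a
    product of those x_ij^+-1 that fix e_r, namely those with j != r. Indeed g
    is then a product of powers of the x_rj, which can be read off from the
    matrix, and of an element for the remaining n - 1 indices
    ([colStab_split]). The stabiliser is determined rank by rank.

    - Two indices ([gen2_stab]). The elements whose first column is reduced to
      a signed basis vector by the subtractive Euclidean algorithm form a set
      which is stable under left multiplication by the generators. The
      generators agree with the steps of the algorithm, except where these
      change direction, and there the braid relation applies.

    - Three indices ([SL3_decomp]). To each index d belongs a set of elements g
      for which the vector g e_r is reached in a standard way: one moves from
      the axis of d inside a coordinate plane containing d, and then inside the
      plane of the two other indices. Multiplication by x_ij preserves this set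
      if j != d, hence it preserves two of the three sets. If all entries of g
      e_r are nonzero and the a-th is the largest, then suitable powers
      x_ab^+-1 and x_ac^+-1 both make the vector shorter; by induction on its
      length the three sets contain the same elements over it
      ([allPlanes_all]). If an entry vanishes, the group of two indices settles
      the matter. So the three sets are equal, and stable under all generators.

    - More indices ([chain_step]). No further vectors have to be examined. With
      p and q the last two indices, the products of an element for the indices
      {p, q}, of one for all indices but q, and of one for the generators
      fixing e_r form a set that is stable under the generators: those for the
      indices {p - 1, p} are the only ones that need an argument, and they are
      handled by the result for the three indices p - 1, p, q.

    It remains to pass to two generators. Gaussian elimination shows that the
    e_ij generate ([SL_generated]). As generators take a = e_01 and the product
    b of the Weyl elements w_10, w_21, ..., which moves each index to the next
    one. From a and b one gets e_(0,l) as a commutator of two elements of the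
    same kind for the two halves of l, so that its length is O(l^2), and then
    all e_ij as words of length O(n^2) ([short_nx]). Substituting these words
    in the Steinberg relators, and adding two relators that express a and b by
    the words, yields a presentation ([two_gen_presents]) with O(n^4) relators
    of length O(n^2) and one of length O(n^3). *)

(** * Generated subgroups *)

Section Generated.
Variable K : groupType.
Implicit Types (A B E : K -> Prop) (g h : K).

(** The generated subgroup. Words grow on the left, so that a set contains the
    subgroup as soon as it contains 1 and is stable under left multiplication
    by the generators; all decompositions below are proved in this way, by
    [gen_act]. *)
Inductive gen A : K -> Prop :=
| gen1 : gen A 1
| genMl a g : A a -> gen A g -> gen A (a * g)
| genVl a g : A a -> gen A g -> gen A (a^-1 * g).

Lemma gen_act A E :
    (forall a g, A a -> E g -> E (a * g)) ->
    (forall a g, A a -> E g -> E (a^-1 * g)) ->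
  forall g h, gen A g -> E h -> E (g * h).
Proof.
move=> EM EV g h; elim=> [|a {}g Aa _ IH|a {}g Aa _ IH] Eh; rewrite ?mul1g //.
  by rewrite -mulgA; apply: EM => //; apply: IH.
by rewrite -mulgA; apply: EV => //; apply: IH.
Qed.

Lemma genM A g h : gen A g -> gen A h -> gen A (g * h).
Proof. by apply: gen_act => a {}g; [apply: genMl | apply: genVl]. Qed.

Lemma gen_sub A a : A a -> gen A a.
Proof. by move=> Aa; rewrite -[a]mulg1; apply: genMl => //; apply: gen1. Qed.

Lemma gen_subV A a : A a -> gen A a^-1.
Proof. by move=> Aa; rewrite -[_^-1]mulg1; apply: genVl => //; apply: gen1. Qed.

Lemma genV A g : gen A g -> gen A g^-1.
Proof.
elim=> [|a {}g Aa _ IH|a {}g Aa _ IH]; first by rewrite invg1; apply: gen1.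
  by rewrite invgM; apply: genM => //; apply: gen_subV.
by rewrite invgM invgK; apply: genM => //; apply: gen_sub.
Qed.

Lemma genX A g k : gen A g -> gen A (g ^+ k).
Proof.
by move=> Ag; elim: k => [|k IH]; [apply: gen1 | rewrite expgS; apply: genM].
Qed.

Lemma gen_trans A B : (forall a, A a -> gen B a) ->
  forall g, gen A g -> gen B g.
Proof.
move=> AB g; elim=> [|a {}g Aa _ IH|a {}g Aa _ IH]; first exact: gen1.
  by apply: genM => //; apply: AB.
by apply: genM => //; apply: genV; apply: AB.
Qed.

Lemma gen_mono A B : (forall a, A a -> B a) -> forall g, gen A g -> gen B g.
Proof. by move=> AB; apply: gen_trans => a /AB; apply: gen_sub. Qed.

Lemma gen_conj1 A h : (forall a, A a -> gen A (a ^ h)) ->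
  forall g, gen A g -> gen A (g ^ h).
Proof.
move=> Ah g; elim=> [|a {}g Aa _ IH|a {}g Aa _ IH].
- by rewrite conj1g; apply: gen1.
- by rewrite conjMg; apply: genM => //; apply: Ah.
- by rewrite conjMg conjVg; apply: genM => //; apply: genV; apply: Ah.
Qed.

(** For one group to normalise another it must be checked on generators of
    both, and on the inverses of the acting ones: in an infinite group,
    conjugation may map a subgroup into itself without being onto. *)
Lemma gen_conj A B :
    (forall a b, A a -> B b -> gen A (a ^ b) /\ gen A (a ^ b^-1)) ->
  forall g h, gen A g -> gen B h -> gen A (g ^ h).
Proof.
move=> AB g h Ag Bh; elim: Bh g Ag => [|b {}h Bb _ IH|b {}h Bb _ IH] g Ag.
- by rewrite conjg1.
- rewrite conjgM; apply: IH; apply: gen_conj1 Ag => a Aa.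
  by case: (AB a b).
- rewrite conjgM; apply: IH; apply: gen_conj1 Ag => a Aa.
  by case: (AB a b).
Qed.

Lemma gen_commute A B : (forall a b, A a -> B b -> a * b = b * a) ->
  forall g h, gen A g -> gen B h -> g * h = h * g.
Proof.
move=> AB g h Ag Bh; apply: (@commute_sym K).
have cg a : A a -> commute h a.
  move=> Aa; apply: (@commute_sym K).
  elim: Bh => [|b {}h Bb _ IH|b {}h Bb _ IH]; first exact: commute1.
    by apply: commuteM => //; apply: AB.
  by apply: commuteM => //; apply: commuteV; apply: AB.
elim: Ag => [|a {}g Aa _ IH|a {}g Aa _ IH]; first exact: commute1.
  by apply: commuteM => //; apply: cg.
by apply: commuteM => //; apply: commuteV; apply: cg.
Qed.

End Generated.

Section Morphism.
Variables (G H : groupType) (f : G -> H).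
Hypothesis fM : {morph f : g h / g * h}.

Lemma morph_one : f 1 = 1.
Proof. by apply: (mulgI (f 1)); rewrite -fM !mulg1. Qed.

Lemma morph_inv g : f g^-1 = (f g)^-1.
Proof. by apply: (mulgI (f g)); rewrite -fM !mulgV morph_one. Qed.

Lemma morph_exp g k : f (g ^+ k) = f g ^+ k.
Proof. by elim: k => [|k IH]; rewrite ?morph_one // !expgS fM IH. Qed.

End Morphism.

(** * Elementary matrices and Steinberg's relations *)

Section Elementary.
Local Open Scope ring_scope.
Variable n : nat.
Implicit Types (i j k r : 'I_n) (g h : SL n int).

(** The value 1 on the diagonal makes the family total in i and j. *)
Definition elem_mx i j : 'M[int]_n :=
  1%:M + (if i == j then 0 else delta_mx i j).

Fact det_elem_mx i j : \det (elem_mx i j) == 1.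
Proof.
rewrite /elem_mx; case: (eqVneq i j) => [_|ij] /=; first by rewrite addr0 det1.
wlog ltij : i j ij / (j < i)%N => [hw|].
  move: (ij); rewrite neq_ltn => /orP[lij|]; last exact: hw.
  rewrite -det_tr linearD /= trmx1 trmx_delta; apply: hw => //.
  by rewrite eq_sym.
rewrite det_trig.
  rewrite big1 // => k _; rewrite !mxE eqxx /= -[RHS]addr0; congr (_ + _).
  by case: eqP => //= ->; rewrite (negPf ij).
apply/is_trig_mxP => k l ltkl; rewrite !mxE.
rewrite (_ : k == l = false) ?add0r; last by apply/negbTE; rewrite neq_ltn ltkl.
case: (eqVneq k i) => //= ki; case: (eqVneq l j) => //= lj.
by move: ltkl ltij; rewrite ki lj; lia.
Qed.

Definition elem i j : SL n int := MkSL (det_elem_mx i j).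

Lemma SL_ext g h : (forall k r, SLmx g k r = SLmx h k r) -> g = h.
Proof. by move=> gh; apply: val_inj; apply/matrixP. Qed.

Lemma SL_ext1 g h :
  (forall k r, SLmx (g * 1)%g k r = SLmx (h * 1)%g k r) -> g = h.
Proof. by move=> gh; apply: SL_ext => k r; rewrite -[g]mulg1 -[h]mulg1. Qed.

Lemma SLmx1 k r : SLmx (1%g : SL n int) k r = (k == r)%:R.
Proof. by rewrite mxE. Qed.

Lemma SLmxM g h k r : SLmx (g * h)%g k r = \sum_l SLmx g k l * SLmx h l r.
Proof. by rewrite mxE. Qed.

Lemma elemii i : elem i i = 1%g.
Proof. by apply: SL_ext => k r; rewrite !mxE eqxx mxE addr0. Qed.

Lemma elemM i j g k r : i != j ->
  SLmx (elem i j * g)%g k r = SLmx g k r + (if k == i then SLmx g j r else 0).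
Proof.
move=> ij; rewrite SLmxM /= /elem_mx (negPf ij).
under eq_bigr do rewrite !mxE mulrDl.
rewrite big_split /= (bigD1 k) //= eqxx mul1r big1 ?addr0; last first.
  by move=> l /negPf lk; rewrite eq_sym lk mul0r.
congr (_ + _); case: (k == i) => /=; last by rewrite big1 // => l; rewrite mul0r.
rewrite (bigD1 j) //= eqxx mul1r big1 ?addr0 //.
by move=> l /negPf ->; rewrite mul0r.
Qed.

Lemma elemVM i j g k r : i != j ->
  SLmx ((elem i j)^-1 * g)%g k r =
  SLmx g k r - (if k == i then SLmx g j r else 0).
Proof.
move=> ij; rewrite -[in RHS](mulVKg (elem i j) g) !elemM //.
rewrite [j == i]eq_sym (negPf ij) addr0.
by case: eqP => _; rewrite ?addr0 ?subr0 ?addrK.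
Qed.

(** The matrix of a Weyl element is a signed transposition. *)
Lemma elem_weylM i j g k r : i != j ->
  SLmx (elem i j * ((elem j i)^-1 * elem i j) * g)%g k r =
  if k == i then SLmx g j r else if k == j then - SLmx g i r else SLmx g k r.
Proof.
move=> ij; have ji : j != i by rewrite eq_sym.
rewrite -!mulgA !(elemM, elemVM) // ?(negPf ij) ?(negPf ji) ?eqxx.
case: (eqVneq k i) => [->|_]; rewrite ?(negPf ij); first by ring.
by case: (eqVneq k j) => [->|_]; ring.
Qed.

End Elementary.

(** For each pair of indices, the last two relations are those of the classical
    presentation of SL_2(Z). *)
Record steinberg n (K : groupType) (x : 'I_n -> 'I_n -> K) : Prop := {
  st_id i : x i i = 1;
  st_comm i j k l : i != j -> k != l -> j != k -> i != l ->
    x i j * x k l = x k l * x i j;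
  st_chain i j k : i != j -> j != k -> i != k ->
    x i j * x j k = x i k * (x j k * x i j);
  st_braid i j : i != j ->
    x i j * ((x j i)^-1 * x i j) = (x j i)^-1 * (x i j * (x j i)^-1);
  st_order i j : i != j -> (x i j * ((x j i)^-1 * x i j)) ^+ 4 = 1 }.

Lemma elem_steinberg n : steinberg (@elem n).
Proof.
split=> [i|i j k l ij kl jk il|i j k ij jk ik|i j ij|i j ij].
- exact: elemii.
- apply: SL_ext1 => s r; rewrite -!mulgA !elemM //.
  rewrite (negPf jk) [l == i]eq_sym (negPf il) !addr0.
  by rewrite -!addrA; congr (_ + _)%R; rewrite addrC.
- apply: SL_ext1 => s r; rewrite -!mulgA !elemM //.
  have [ji kj ki] : [/\ j != i, k != j & k != i] by split; rewrite eq_sym.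
  rewrite ?(negPf ji) ?(negPf kj) ?(negPf ki) ?(negPf ij) ?(negPf jk) ?eqxx.
  by do 2 case: eqP => [->|_]; rewrite ?(negPf ij) ?(negPf ji) /=; ring.
- have ji : j != i by rewrite eq_sym.
  apply: SL_ext1 => s r; rewrite -!mulgA.
  rewrite !(elemM, elemVM) // ?(negPf ij) ?(negPf ji) ?eqxx.
  by do 2 case: eqP => [->|_]; rewrite ?(negPf ij) ?(negPf ji) ?eqxx /=; ring.
- have ji : j != i by rewrite eq_sym.
  have := fun g k r => @elem_weylM n i j g k r ij.
  move: (_ * (_ * _)) => w wE.
  apply: SL_ext1 => s r; rewrite !expgS expg0 -!mulgA !wE.
  rewrite !eqxx (negPf ji); case: (eqVneq s i) => [->|_]; rewrite ?opprK //.
  by case: (eqVneq s j) => [->|_]; rewrite ?opprK.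
Qed.

(** * Weyl elements *)

Ltac dneq := solve [done | by rewrite eq_sym].
Ltac oneq := by apply/eqP => /(congr1 (@nat_of_ord _)) /=; lia.

Section Weyl.
Variables (n : nat) (K : groupType) (x : 'I_n -> 'I_n -> K).
Hypothesis S : steinberg x.
Implicit Types i j k l : 'I_n.

Definition signed (b : bool) (g : K) := if b then g^-1 else g.

(** Over the signed transposition that sends e_j to e_i and e_i to - e_j.
    Locked, so that rewriting with associativity does not look inside. *)
Definition weyl i j := locked (x i j * ((x j i)^-1 * x i j)).

Lemma weylE i j : weyl i j = x i j * ((x j i)^-1 * x i j).
Proof. by rewrite /weyl -lock. Qed.

Lemma weyl_braid i j : i != j -> weyl i j = (x j i)^-1 * (x i j * (x j i)^-1).
Proof. by rewrite weylE; apply: (st_braid S). Qed.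

Lemma weyl_order i j : i != j -> weyl i j ^+ 4 = 1.
Proof. by rewrite weylE; apply: (st_order S). Qed.

Lemma weyl_id i : weyl i i = 1.
Proof. by rewrite weylE (st_id S) !gnorm. Qed.

Lemma weylV i j : i != j -> (weyl i j)^-1 = weyl j i.
Proof.
by move=> ij; rewrite (weyl_braid ij) weylE !invgM !invgK -!mulgA.
Qed.

Lemma st_conj i j k l : i != j -> k != l -> j != k -> i != l ->
  x i j ^ x k l = x i j.
Proof.
by move=> ij kl jk il; rewrite /conjg (st_comm S ij kl jk il) mulKg.
Qed.

Lemma st_conjV i j k l : i != j -> k != l -> j != k -> i != l ->
  x i j ^ (x k l)^-1 = x i j.
Proof. by move=> ij kl jk il; rewrite -{1}(st_conj ij kl jk il) conjgK. Qed.

Section Triple.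
Variables i j k : 'I_n.
Hypotheses (ij : i != j) (jk : j != k) (ik : i != k).

Lemma st_conjlV : x j k ^ (x i j)^-1 = x i k * x j k.
Proof.
by rewrite /conjg invgK mulgA (st_chain S ij jk ik) -!mulgA mulgV mulg1.
Qed.

Lemma st_conjl : x j k ^ x i j = (x i k)^-1 * x j k.
Proof.
apply: (mulgI (x i k)); rewrite mulVKg -[RHS](conjgKV (x i j)) st_conjlV conjMg.
by rewrite (@st_conj i k i j) //; dneq.
Qed.

Lemma st_conjr : x i j ^ x j k = x i k * x i j.
Proof.
rewrite /conjg (st_chain S ij jk ik) !mulgA -(mulgA _ (x i k)).
by rewrite (@st_comm _ _ _ S i k j k) ?mulKg //; dneq.
Qed.

Lemma st_conjrV : x i j ^ (x j k)^-1 = (x i k)^-1 * x i j.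
Proof.
apply: (mulgI (x i k)); rewrite mulVKg -[RHS](conjgK (x j k)) st_conjr conjMg.
by rewrite (@st_conjV i k j k) //; dneq.
Qed.

End Triple.

(** Weyl elements permute the generators as signed transpositions permute the
    matrix units: an index i contributes a sign. *)
Lemma weyl_conj i j k l : i != j -> k != l ->
  x k l ^ (weyl i j)^-1 =
  signed ((k == i) (+) (l == i)) (x (tperm i j k) (tperm i j l)).
Proof.
move=> ij kl; have ji : j != i by dneq.
have wE g : g ^ (weyl i j)^-1 = ((g ^ (x i j)^-1) ^ x j i) ^ (x i j)^-1.
  by rewrite -!conjgM weylE !invgM invgK !mulgA.
have wC g h : weyl i j * g = h * weyl i j -> g ^ (weyl i j)^-1 = h.
  by move=> gh; rewrite /conjg invgK mulgA gh mulgK.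
have w_ij : x i j ^ (weyl i j)^-1 = (x j i)^-1.
  by apply: wC; rewrite {1}(weyl_braid ij) weylE -!mulgA.
have w_ji : x j i ^ (weyl i j)^-1 = (x i j)^-1.
  by apply: wC; rewrite {1}(weyl_braid ij) weylE !gnorm.
have [ki|ki] := eqVneq k i; [|have [kj|kj] := eqVneq k j];
  (have [li|li] := eqVneq l i; [|have [lj|lj] := eqVneq l j]);
  subst; rewrite ?(negPf ij) ?(negPf ji) ?eqxx ?tpermL ?tpermR /=;
  try (by rewrite eqxx in kl); rewrite ?tpermD //; try dneq;
  rewrite ?w_ij ?w_ji // wE.
- rewrite (@st_conjV i l i j) 1?(@st_conjl j i l); try dneq.
  rewrite (conjMg (x j l)^-1) conjVg; try dneq.
  by rewrite (@st_conjlV i j l) 1?(@st_conjV i l i j) ?gnorm //; dneq.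
- rewrite (@st_conjlV i j l) 1?(conjMg (x i l)); try dneq.
  rewrite (@st_conjl j i l) 1?(@st_conj j l j i) -1?mulgA; try dneq.
  rewrite -/(conjg _ _) (@st_conj i l j l) 1?(@st_conjV i l i j) //; dneq.
- rewrite (@st_conjrV k i j) 1?(conjMg (x k j)^-1) 1?conjVg; try dneq.
  rewrite (@st_conjr k j i) 1?(@st_conj k i j i) ?gnorm; try dneq.
  by rewrite conjVg (@st_conjV k j i j) //; dneq.
- rewrite (@st_conjV k j i j) 1?(@st_conjr k j i) 1?(conjMg (x k i)); try dneq.
  rewrite (@st_conjrV k i j) 1?(@st_conjV k j i j) -1?mulgA; try dneq.
  by rewrite -/(conjg _ _) (@st_conj k i k j) //; dneq.
- by rewrite !(st_conj, st_conjV) //; dneq.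
Qed.

Lemma signedV b g : signed (~~ b) g = (signed b g)^-1.
Proof. by case: b; rewrite /= ?invgK. Qed.

Lemma signed_add b c g : signed b (signed c g) = signed (b (+) c) g.
Proof. by case: b; case: c; rewrite /= ?invgK. Qed.

Lemma signed_conj b g h : signed b g ^ h = signed b (g ^ h).
Proof. by case: b => //=; rewrite conjVg. Qed.

Lemma weyl_conjM i j k l : i != j -> k != l ->
  x k l ^ weyl i j =
  signed ((k == j) (+) (l == j)) (x (tperm i j k) (tperm i j l)).
Proof.
move=> ij kl; rewrite -[weyl i j]invgK weylV // (@weyl_conj j i) //; last dneq.
by rewrite tpermC.
Qed.

Lemma weyl_conj_weyl i j k l : i != j -> k != l ->
  weyl k l ^ (weyl i j)^-1 =
  signed ((k == i) (+) (l == i)) (weyl (tperm i j k) (tperm i j l)).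
Proof.
move=> ij kl; have lk : l != k by dneq.
rewrite [in LHS]weylE (conjMg (x k l)) (conjMg (x l k)^-1) conjVg !weyl_conj //.
rewrite [(l == i) (+) _]addbC; case: (_ (+) _) => /=; rewrite weylE //.
by rewrite !invgM !invgK mulgA.
Qed.

End Weyl.

(** * Two indices: the Euclidean algorithm *)

Section Signs.
Local Open Scope ring_scope.

(** One step of the subtractive Euclidean algorithm on a vector (p, q): the
    effect on its signs and absolute values of adding (-1)^e q to p. *)
Lemma euclid_cases (e : bool) (p q : int) : q != 0 ->
  if 0 <= (-1) ^+ e * p * q then
    `|q| <= `|p + (-1) ^+ e * q| /\ (0 < (p + (-1) ^+ e * q) * q) = ~~ e
  else (0 < p * q) = e /\
   (`|p| = `|q| -> q + (-1) ^+ e * p = 0) /\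
   (`|p| < `|q| -> [/\ 0 < `|p + (-1) ^+ e * q|,
      `|p + (-1) ^+ e * q| <= `|q| &
      (0 < (p + (-1) ^+ e * q) * q) = ~~ e]).
Proof.
case: e; rewrite ?expr0 ?expr1 ?mul1r ?mulN1r /=.
  case: (ltrgt0P q) => // q0 _.
    by rewrite pmulr_lge0 // !pmulr_lgt0 //; case: ifP => h; repeat split=> *; lia.
  by rewrite nmulr_lge0 // !nmulr_lgt0 //; case: ifP => h; repeat split=> *; lia.
case: (ltrgt0P q) => // q0 _.
  by rewrite pmulr_lge0 // !pmulr_lgt0 //; case: ifP => h; repeat split=> *; lia.
by rewrite nmulr_lge0 // !nmulr_lgt0 //; case: ifP => h; repeat split=> *; lia.
Qed.

End Signs.

Section Action.
Local Open Scope ring_scope.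
Variables (n : nat) (K : groupType) (x : 'I_n -> 'I_n -> K).
Variable m : K -> SL n int.
Hypothesis S : steinberg x.
Hypothesis mM : {morph m : g h / (g * h)%g}.
Hypothesis mx : forall i j, m (x i j) = elem i j.
Implicit Types i j k l r : 'I_n.
Local Notation E g := (SLmx (m g)).
Local Notation w := (weyl x).

Lemma ent1 k r : E 1%g k r = (k == r)%:R.
Proof. by rewrite (morph_one mM) SLmx1. Qed.

Lemma entM g h k r : E (g * h)%g k r = \sum_l E g k l * E h l r.
Proof. by rewrite mM SLmxM. Qed.

Lemma ent_xM i j g k r : i != j ->
  E (x i j * g)%g k r = E g k r + (if k == i then E g j r else 0).
Proof. by move=> ij; rewrite mM mx elemM. Qed.

Lemma ent_xVM i j g k r : i != j ->
  E ((x i j)^-1 * g)%g k r = E g k r - (if k == i then E g j r else 0).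
Proof. by move=> ij; rewrite mM (morph_inv mM) mx elemVM. Qed.

Lemma ent_sxM b i j g k r : i != j ->
  E (signed b (x i j) * g)%g k r =
  E g k r + (if k == i then (-1) ^+ b * E g j r else 0).
Proof.
case: b => ij; rewrite /= ?expr0 ?expr1 ?mul1r ?ent_xVM ?ent_xM //.
by case: eqP; rewrite ?mulN1r ?oppr0.
Qed.

Lemma ent_weylM i j g k r : i != j ->
  E (w i j * g)%g k r =
  if k == i then E g j r else if k == j then - E g i r else E g k r.
Proof. by move=> ij; rewrite weylE !mM (morph_inv mM) !mx elem_weylM. Qed.

Section SL2.
Variables a b : 'I_n.
Hypothesis ab : a != b.
Local Notation X := (x a b).
Local Notation Y := (x b a).
Local Notation W := (w a b).
Local Notation p g := (E g a a).
Local Notation q g := (E g b a).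

Let ba : b != a. Proof. by rewrite eq_sym. Qed.

Lemma WX s : (W * signed s X = signed (~~ s) Y * W)%g.
Proof.
have := weyl_conj S ab ab; rewrite eqxx (negPf ba) tpermL tpermR /=.
rewrite /conjg invgK => WX.
have {}WX : (W * X = Y^-1 * W)%g by rewrite -WX !gnorm.
case: s => //=; apply: (mulIg X); rewrite mulgVK -mulgA WX mulgA mulgV mul1g //.
Qed.

Lemma WY s : (W * signed s Y = signed (~~ s) X * W)%g.
Proof.
have := weyl_conj S ab ba; rewrite eqxx (negPf ba) tpermL tpermR /=.
rewrite /conjg invgK => WX.
have {}WX : (W * Y = X^-1 * W)%g by rewrite -WX !gnorm.
case: s => //=; apply: (mulIg Y); rewrite mulgVK -mulgA WX mulgA mulgV mul1g //.
Qed.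

Lemma WWX s (k : nat) : (W ^+ (k * 2) * signed s X = signed s X * W ^+ (k * 2))%g.
Proof.
rewrite mulnC expgnA; apply: commute_sym; apply: commuteX.
by rewrite /commute expg2 -[RHS]mulgA WX [RHS]mulgA WY negbK mulgA.
Qed.

Lemma signedX e : signed e X = (signed e Y * signed e W * signed e Y)%g.
Proof.
have WE : X = (Y * W * Y)%g by rewrite (weyl_braid S ab) !gnorm.
by case: e => //=; rewrite [in LHS]WE !gnorm.
Qed.

(** The elements whose column (p, q) the Euclidean algorithm takes to a signed
    basis vector along the generators; when `|p| = `|q| both of its steps are
    allowed. *)
Inductive euclid : K -> Prop :=
| Euclid0 (k : nat) u g : gen (eq X) u -> g = (W ^+ k * u)%g -> euclid g
| EuclidX s g : 0 < `|q g| -> `|q g| <= `|p g| -> (0 < p g * q g) = s ->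
    euclid (signed s X * g)%g -> euclid g
| EuclidY s g : 0 < `|p g| -> `|p g| <= `|q g| -> (0 < p g * q g) = s ->
    euclid (signed s Y * g)%g -> euclid g.

Lemma col_genX u : gen (eq X) u -> p u = 1 /\ q u = 0.
Proof.
elim=> [|a' {}u <- _ [pu qu]|a' {}u <- _ [pu qu]].
- by rewrite !ent1 eqxx (negPf ba).
- by rewrite !ent_xM // eqxx (negPf ba) pu qu !addr0.
- by rewrite !ent_xVM // eqxx (negPf ba) pu qu !subr0.
Qed.

(** The parity of the exponent of W is visible on the column. *)
Lemma col_Wu (k : nat) u : gen (eq X) u ->
  if odd k then p (W ^+ k * u)%g = 0 /\ `|q (W ^+ k * u)%g| = 1
  else `|p (W ^+ k * u)%g| = 1 /\ q (W ^+ k * u)%g = 0.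
Proof.
move=> /col_genX[pu qu]; elim: k => [|k]; first by rewrite /= mul1g pu qu normr1.
rewrite expgS -mulgA !ent_weylM // !eqxx (negPf ba) /=.
by case: odd => -[pE qE] /=; rewrite ?normrN ?pE ?qE ?oppr0.
Qed.

Lemma pW g : p (W * g)%g = q g. Proof. by rewrite ent_weylM // eqxx. Qed.

Lemma qW g : q (W * g)%g = - p g. Proof. by rewrite ent_weylM // (negPf ba) eqxx. Qed.

Lemma euclid_W g : euclid g -> euclid (W * g)%g.
Proof.
have flip (u v : int) : 0 < `|u| -> 0 < `|v| -> (0 < v * - u) = ~~ (0 < u * v).
  by move=> u0 v0; apply/idP/idP; nia.
elim=> [k u {}g uX ->|s {}g q0 qp <- _ IH|s {}g p0 pq <- _ IH].
- by apply: (@Euclid0 k.+1 u) => //; rewrite expgS mulgA.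
- have p0 := lt_le_trans q0 qp.
  apply: (@EuclidY (~~ (0 < p g * q g))); rewrite ?pW ?qW ?normrN //.
    exact: flip.
  by rewrite mulgA -WX -mulgA.
- have q0 := lt_le_trans p0 pq.
  apply: (@EuclidX (~~ (0 < p g * q g))); rewrite ?pW ?qW ?normrN //.
    exact: flip.
  by rewrite mulgA -WY -mulgA.
Qed.

Lemma euclid_Ws e g : euclid g -> euclid (signed e W * g)%g.
Proof.
case: e => /=; last exact: euclid_W.
have -> : (W^-1 = W ^+ 3)%g.
  by apply: (mulgI W); rewrite -expgS weyl_order // mulgV.
by move=> Tg; rewrite !expgS expg0 mulg1 -!mulgA; do 3 apply: euclid_W.
Qed.

Lemma euclid_col0 g : euclid g -> q g = 0 ->
  exists (k : nat) u, gen (eq X) u /\ g = (W ^+ (k * 2) * u)%g.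
Proof.
case=> [k u {}g uX gE|s {}g q0 _ _ _ qE|s {}g p0 pq _ _ qE]; last 2 first.
- by rewrite qE normr0 ltxx in q0.
- by have := lt_le_trans p0 pq; rewrite qE normr0 ltxx.
move=> qE; have := col_Wu k uX; rewrite -gE qE.
case: ifP => [_ [_ /eqP]|/negbT ok _]; first by rewrite normr0.
exists k./2, u; split=> //; rewrite gE; congr (_ ^+ _ * _)%g.
by rewrite muln2 even_halfK.
Qed.

(** Either multiplication by X undoes a step of the algorithm, or it is such a
    step, or the algorithm has to continue with Y. In this last case X = Y W Y,
    and W only exchanges the roles of X and Y. *)
Lemma euclid_X e g : euclid g -> euclid (signed e X * g)%g.
Proof.
move=> Tg; have pX : p (signed e X * g)%g = p g + (-1) ^+ e * q g.
  by rewrite ent_sxM // eqxx.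
have qX : q (signed e X * g)%g = q g by rewrite ent_sxM // (negPf ba) addr0.
have pY : p (signed e Y * g)%g = p g by rewrite ent_sxM // (negPf ab) addr0.
have qY : q (signed e Y * g)%g = q g + (-1) ^+ e * p g.
  by rewrite ent_sxM // eqxx.
have [q0|q0] := eqVneq (q g) 0.
  have [k [u [uX ->]]] := euclid_col0 Tg q0.
  rewrite mulgA -WWX -mulgA; apply: Euclid0 erefl.
  by case: e {pX qX pY qY}; [apply: genVl | apply: genMl].
have nq0 : 0 < `|q g| by rewrite normr_gt0.
have := euclid_cases e (p g) q0.
case: ifP => d; [case=> qp sE | case=> se [eqE ltE]].
  apply: (@EuclidX (~~ e)); rewrite ?pX ?qX //.
  by rewrite signedV mulKg.
case: Tg pX qX pY qY q0 nq0 se eqE ltE d =>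
    [k u {}g uX gE|s {}g _ qp sE TX|s {}g p0 pq sE TY] pX qX pY qY q0 nq0 se eqE ltE d.
- have := col_Wu k uX; rewrite -gE.
  case: ifP => _ [] => [pE _|_ qE]; last by rewrite qE eqxx in q0.
  by rewrite pE mulr0 mul0r lexx in d.
- by rewrite -se sE.
rewrite -sE se in TY.
have XY : (signed e X * g = signed e Y * (signed e W * (signed e Y * g)))%g.
  by rewrite signedX -!mulgA.
(* On the diagonal the Y-step ends on an axis, which determines the element. *)
have [eqpq|ltpq] := eqVneq `|p g| `|q g|.
  have qY0 : q (signed e Y * g)%g = 0 by rewrite qY eqE.
  have [k [u [uX YE]]] := euclid_col0 TY qY0; rewrite XY YE.
  have -> : (signed e Y * (signed e W * (W ^+ (k * 2) * u)) =
             signed e W * (W ^+ (k * 2) * (signed (~~ e) X * u)))%g.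
    rewrite [RHS]mulgA [in RHS]mulgA -(mulgA (signed e W)) WWX !mulgA.
    congr (_ * _ * _)%g; case: (e) => /=; last by rewrite -(WX true).
    by apply: (mulgI W); rewrite mulVKg !mulgA -[_^-1%g]/(signed true Y) WY /= mulgK.
  apply: euclid_Ws; apply: Euclid0 erefl.
  by case: (e); [apply: genMl | apply: genVl].
have {ltE}[|p'0 p'q se'] := ltE; first by rewrite lt_neqAle ltpq.
apply: (@EuclidY (~~ e)); rewrite ?pX ?qX //.
by rewrite XY signedV mulKg; apply: euclid_Ws.
Qed.

Lemma euclid_Y e g : euclid g -> euclid (signed e Y * g)%g.
Proof.
move=> Tg; have -> : signed e Y = (W * signed (~~ e) X * W^-1)%g.
  by rewrite WX negbK mulgK.
by rewrite -!mulgA; apply: euclid_W; apply: euclid_X; apply: (euclid_Ws true).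
Qed.

Definition gen2 i j := gen (fun g => g = x i j \/ g = x j i).

(** Elements with a triangular image are the evident ones. Exponents of W are
    even because q vanishes, and W^2 lies over -1 in the two coordinates. *)
Lemma gen2_stab g : gen2 a b g -> q g = 0 ->
  exists (k : nat) u, gen (eq X) u /\ g = (W ^+ (k * 2) * u)%g.
Proof.
move=> gab; apply: euclid_col0; rewrite -[g]mulg1.
apply: (gen_act _ _ gab) => [_ h [->|->]|_ h [->|->]|].
- exact: (euclid_X false).
- exact: (euclid_Y false).
- exact: (euclid_X true).
- exact: (euclid_Y true).
- by apply: (@Euclid0 0 1%g); [apply: gen1 | rewrite mulg1].
Qed.

End SL2.
End Action.

(** * Subgroups attached to sets of indices *)

Section WeylAction.
Variables (n : nat) (K : groupType) (x : 'I_n -> 'I_n -> K).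
Hypothesis S : steinberg x.
Implicit Types i j k l : 'I_n.
Local Notation w := (weyl x).

Definition gamma (D : pred 'I_n) := gen (fun g =>
  exists i j, [/\ D i, D j, i != j & g = x i j]).

(** The generators that fix e_r; that they generate its stabiliser is the
    content of [chain_stab]. *)
Definition colStab (D : pred 'I_n) r := gen (fun g =>
  exists i j, [/\ D i, D j, i != j, j != r & g = x i j]).

Lemma gen_signed (A : K -> Prop) s a : A a -> gen A (signed s a).
Proof. by case: s => Aa; [apply: gen_subV | apply: gen_sub]. Qed.

Lemma mulg_conj (h u g : K) : h^-1 * (u * g) = u ^ h * (h^-1 * g).
Proof. by rewrite /conjg -!mulgA mulVKg. Qed.

Lemma weylVE i j : (w i j)^-1 = w j i.
Proof.
by have [<-|ij] := eqVneq i j; [rewrite weyl_id ?invg1 | apply: weylV].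
Qed.

Lemma weyl_conj_ex i j k l : k != l ->
  exists s, x k l ^ w i j = signed s (x (tperm i j k) (tperm i j l)).
Proof.
move=> kl; have [<-|ij] := eqVneq i j.
  by exists false; rewrite weyl_id // conjg1 tperm1 !perm1.
by eexists; apply: weyl_conjM.
Qed.

Lemma weyl_conj_weyl_ex i j k l : k != l ->
  exists s, w k l ^ w i j = signed s (w (tperm i j k) (tperm i j l)).
Proof.
move=> kl; have [<-|ij] := eqVneq i j.
  by exists false; rewrite weyl_id // conjg1 tperm1 !perm1.
by eexists; rewrite -(weylVE j i) tpermC weyl_conj_weyl //; dneq.
Qed.

Lemma gen2_sym i j g : gen2 x i j g -> gen2 x j i g.
Proof. by apply: gen_mono => a [->|->]; [right | left]. Qed.

Lemma gen2_weyl i j : gen2 x i j (w i j).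
Proof.
rewrite weylE; apply: genM; first by apply: gen_sub; left.
by apply: genM; [apply: gen_subV; right | apply: gen_sub; left].
Qed.

Lemma gen2_conj_weyl i j k l g : i != j -> gen2 x i j g ->
  gen2 x (tperm k l i) (tperm k l j) (g ^ w k l).
Proof.
move=> ij; have ji : j != i by dneq.
elim=> [|a {}g Aa _ IH|a {}g Aa _ IH]; first by rewrite conj1g; apply: gen1.
  rewrite conjMg; apply: genM => //; case: Aa => ->.
    by have [s ->] := weyl_conj_ex k l ij; apply: gen_signed; left.
  by have [s ->] := weyl_conj_ex k l ji; apply: gen_signed; right.
rewrite conjMg conjVg; apply: genM => //; apply: genV; case: Aa => ->.
  by have [s ->] := weyl_conj_ex k l ij; apply: gen_signed; left.
by have [s ->] := weyl_conj_ex k l ji; apply: gen_signed; right.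
Qed.

Lemma gen2_conj_weylX i j k l s g : i != j -> gen2 x i j g ->
  gen2 x i j (g ^ (w k l ^+ (s * 2))).
Proof.
move=> ij; elim: s g => [|s IH] g Ag; first by rewrite conjg1.
rewrite mulSn expgnDr conjgM expg2 conjgM; apply: IH.
rewrite -(tpermK k l i) -(tpermK k l j).
by apply: gen2_conj_weyl; [rewrite (inj_eq perm_inj) | apply: gen2_conj_weyl].
Qed.

Section Triple.
Variables d e f : 'I_n.
Hypotheses (de : d != e) (ef : e != f) (df : d != f).

(** The transvections with a common row form an abelian group, on which the
    elements for the two other indices act as on row vectors. *)
Lemma row_conj u g : gen (fun h => h = x d e \/ h = x d f) u ->
  gen2 x e f g -> gen (fun h => h = x d e \/ h = x d f) (u ^ g).
Proof.
have Ae : gen (fun h => h = x d e \/ h = x d f) (x d e) by apply: gen_sub; left.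
have Af : gen (fun h => h = x d e \/ h = x d f) (x d f) by apply: gen_sub; right.
apply: gen_conj => _ _ [->|->] [->|->]; split.
- by rewrite (@st_conjr _ _ _ S d e f) //; apply: genM.
- by rewrite (@st_conjrV _ _ _ S d e f) //; apply: genM => //; apply: genV.
- by rewrite (@st_conj _ _ _ S d e f e) //; dneq.
- by rewrite (@st_conjV _ _ _ S d e f e) //; dneq.
- by rewrite (@st_conj _ _ _ S d f e f) //; dneq.
- by rewrite (@st_conjV _ _ _ S d f e f) //; dneq.
- by rewrite (@st_conjr _ _ _ S d f e) //; [apply: genM | dneq].
- rewrite (@st_conjrV _ _ _ S d f e) //; last dneq.
  by apply: genM => //; apply: genV.
Qed.

Lemma col_conj u g : gen (fun h => h = x d f \/ h = x e f) u ->
  gen2 x d e g -> gen (fun h => h = x d f \/ h = x e f) (u ^ g).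
Proof.
have Ad : gen (fun h => h = x d f \/ h = x e f) (x d f) by apply: gen_sub; left.
have Ae : gen (fun h => h = x d f \/ h = x e f) (x e f) by apply: gen_sub; right.
apply: gen_conj => _ _ [->|->] [->|->]; split.
- by rewrite (@st_conj _ _ _ S d f d e) //; dneq.
- by rewrite (@st_conjV _ _ _ S d f d e) //; dneq.
- rewrite (@st_conjl _ _ _ S e d f) //; last dneq.
  by apply: genM => //; apply: genV.
- by rewrite (@st_conjlV _ _ _ S e d f) //; [apply: genM | dneq].
- by rewrite (@st_conjl _ _ _ S d e f) //; apply: genM => //; apply: genV.
- by rewrite (@st_conjlV _ _ _ S d e f) //; apply: genM.
- by rewrite (@st_conj _ _ _ S e f e d) //; dneq.
- by rewrite (@st_conjV _ _ _ S e f e d) //; dneq.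
Qed.

End Triple.
End WeylAction.

(** * Three indices *)

Section SL3.
Local Open Scope ring_scope.
Variables (n : nat) (K : groupType) (x : 'I_n -> 'I_n -> K).
Variable m : K -> SL n int.
Hypothesis S : steinberg x.
Hypothesis mM : {morph m : g h / (g * h)%g}.
Hypothesis mx : forall i j, m (x i j) = elem i j.
Implicit Types i j k l : 'I_n.
Local Notation E g := (SLmx (m g)).
Local Notation w := (weyl x).

Lemma gen2_row i j k r g h : i != j -> gen2 x i j g -> k != i -> k != j ->
  E (g * h)%g k r = E h k r.
Proof.
move=> ij; have ji : j != i by dneq.
move=> Ag /negPf ki /negPf kj.
elim: Ag => [|a {}g [->|->] _ IH|a {}g [->|->] _ IH].
- by rewrite mul1g.
- by rewrite -mulgA (ent_xM mM mx) // ki addr0.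
- by rewrite -mulgA (ent_xM mM mx) // kj addr0.
- by rewrite -mulgA (ent_xVM mM mx) // ki subr0.
- by rewrite -mulgA (ent_xVM mM mx) // kj subr0.
Qed.

Lemma gen2_col i j l k g : i != j -> gen2 x i j g -> l != i -> l != j ->
  E g k l = (k == l)%:R.
Proof.
move=> ij; have ji : j != i by dneq.
move=> Ag li lj.
elim: Ag k => [|a {}g [->|->] _ IH|a {}g [->|->] _ IH] k.
- by rewrite (ent1 mM).
- by rewrite (ent_xM mM mx) // !IH [j == l]eq_sym (negPf lj) if_same addr0.
- by rewrite (ent_xM mM mx) // !IH [i == l]eq_sym (negPf li) if_same addr0.
- by rewrite (ent_xVM mM mx) // !IH [j == l]eq_sym (negPf lj) if_same subr0.
- by rewrite (ent_xVM mM mx) // !IH [i == l]eq_sym (negPf li) if_same subr0.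
Qed.

Lemma gen2_mul i j k r g h : i != j -> gen2 x i j g -> k = i \/ k = j ->
  E (g * h)%g k r = E g k i * E h i r + E g k j * E h j r.
Proof.
move=> ij Ag kij; rewrite (entM mM) (bigD1 i) //= (bigD1 j) 1?eq_sym //=.
rewrite addrA big1 ?addr0 // => l /andP[li lj].
rewrite (gen2_col k ij Ag) //; case: eqP => [kl|]; last by rewrite mul0r.
by case: kij; rewrite kl => eE; rewrite eE eqxx in li lj.
Qed.

(** The length of the vector in which the induction for three indices, and
    Gaussian elimination, proceed. *)
Definition height (D : pred 'I_n) r g := (\sum_(k | D k) `|E g k r|)%N.

Lemma height_descent (D : pred 'I_n) r i y g : D i -> i != y ->
    E g y r != 0 -> `|E g y r| <= `|E g i r| ->
  exists s, (height D r (signed s (x i y) * g)%g < height D r g)%N.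
Proof.
move=> Di iy y0 leyi; exists (0 < E g i r * E g y r).
rewrite /height [X in (X < _)%N](bigD1 i) //= [X in (_ < X)%N](bigD1 i) //=.
rewrite (ent_sxM mM mx) // eqxx.
under [X in (_ + X < _)%N]eq_bigr => k /andP[_ ki].
  rewrite (ent_sxM mM mx) // (negPf ki) addr0; over.
rewrite ltn_add2r; move: (E g i r) (E g y r) y0 leyi => p q q0 qp.
have [pq|pq] := boolP (0 < p * q); rewrite ?expr1 ?expr0 ?mulN1r ?mul1r;
  case: (ltrgt0P q) q0 pq qp => // q0 _.
- by rewrite pmulr_lgt0 //; lia.
- by rewrite nmulr_lgt0 //; lia.
- by rewrite pmulr_lgt0 //; lia.
- by rewrite nmulr_lgt0 //; lia.
Qed.

Variables a b c : 'I_n.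
Hypotheses (ab : a != b) (bc : b != c) (ac : a != c).
Definition T3 := [pred k | [|| k == a, k == b | k == c]].
Local Notation T := T3.

Definition tri d e f : Prop := [/\ d != e, e != f, d != f & [/\ T d, T e & T f]].

Lemma tri_swap d e f : tri d e f -> tri d f e.
Proof. by case=> de ef df [Td Te Tf]; split=> //; dneq. Qed.

Lemma tri_rot d e f : tri d e f -> tri e f d.
Proof. by case=> de ef df [Td Te Tf]; split=> //; dneq. Qed.

Lemma tri_mem d e f k : tri d e f -> T k -> [\/ k = d, k = e | k = f].
Proof.
case=> de ef df [Td Te Tf] Tk.
have : [|| k == d, k == e | k == f].
  move: de ef df; move/or3P: Td => [] /eqP->; move/or3P: Te => [] /eqP->;
  move/or3P: Tf => [] /eqP->; move/or3P: Tk => [] /eqP->;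
  by rewrite ?eqxx ?orbT.
by move/or3P=> [] /eqP ->; [apply: Or31 | apply: Or32 | apply: Or33].
Qed.

Variable r : 'I_n.
Hypothesis Tr : T r.

(** Elements preserving the line through e_r; the squares of the Weyl elements
    lie over diagonal matrices with entries +-1. *)
Definition lineStab := gen (fun g =>
  (exists k l, [/\ T k, T l, k != l, l != r & g = x k l]) \/
  (exists k l, [/\ T k, T l, k != l & g = (w k l ^+ 2)%g])).

(** The known elements g with g e_r = +-e_d. For d = r the Weyl element is 1. *)
Definition onAxis d g := lineStab ((w d r)^-1 * g)%g.

Lemma lineStab_x s k l : T k -> T l -> k != l -> l != r ->
  lineStab (signed s (x k l)).
Proof. by move=> Tk Tl kl lr; apply: gen_signed; left; exists k, l. Qed.

Lemma lineStab_weyl s k l : T k -> T l -> k != l -> k != r -> l != r ->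
  lineStab (signed s (w k l)).
Proof.
move=> Tk Tl kl kr lr; have lk : l != k by dneq.
have wkl : lineStab (w k l).
  rewrite weylE; apply: genM; first exact: (lineStab_x false).
  by apply: genM; [apply: (lineStab_x true) | apply: (lineStab_x false)].
by case: s => //=; apply: genV.
Qed.

Lemma lineStab_weyl2 k l : T k -> T l -> k != l -> lineStab (w k l * w k l)%g.
Proof.
by move=> Tk Tl kl; apply: gen_sub; right; exists k, l; rewrite expg2.
Qed.

Lemma T_tperm k l d : T k -> T l -> T d -> T (tperm k l d).
Proof. by move=> Tk Tl Td; case: tpermP. Qed.

Lemma onAxis_x d s k l g : T d -> T k -> T l -> k != l -> l != d ->
  onAxis d g -> onAxis d (signed s (x k l) * g)%g.
Proof.
move=> Td Tk Tl kl ld Og; rewrite /onAxis mulg_conj; apply: genM => //.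
rewrite signed_conj; have [s' ->] := weyl_conj_ex S d r kl.
rewrite signed_add; apply: lineStab_x; rewrite ?T_tperm ?(inj_eq perm_inj) //.
by rewrite -{2}(tpermL d r) (inj_eq perm_inj).
Qed.

(** Weyl elements permute the axes. This amounts to relations between Weyl
    elements modulo [lineStab], read off from their action on each other by
    conjugation. *)
Lemma onAxis_weyl d k l g : T d -> T k -> T l -> k != l ->
  onAxis d g -> onAxis (tperm k l d) (w k l * g)%g.
Proof.
move=> Td Tk Tl kl Og; have lk : l != k by dneq.
suff u_stab : lineStab ((w (tperm k l d) r)^-1 * (w k l * w d r))%g.
  rewrite /onAxis (_ : (_ * _)%g = ((w (tperm k l d) r)^-1 * (w k l * w d r) *
    ((w d r)^-1 * g))%g); last by rewrite -!mulgA mulVKg.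
  exact: genM.
have [?|kr] := eqVneq k r.
  subst k; have [->|dk] := eqVneq d r.
    rewrite tpermL weyl_id // mulg1 weylVE //.
    exact: lineStab_weyl2.
  have [->|dl] := eqVneq d l.
    by rewrite tpermR weyl_id // invg1 mul1g -weylVE // mulVg; apply: gen1.
  rewrite tpermD 1?eq_sym // -/(conjg _ _).
  have [s ->] := weyl_conj_weyl_ex S d r kl.
  by rewrite tpermR tpermD //; apply: lineStab_weyl.
have [?|lr] := eqVneq l r.
  subst l; have [->|dl] := eqVneq d r.
    by rewrite tpermR weyl_id // mulg1 mulVg; apply: gen1.
  have [->|dk] := eqVneq d k.
    by rewrite tpermL weyl_id // invg1 mul1g; apply: lineStab_weyl2.
  rewrite tpermD 1?eq_sym // -/(conjg _ _).
  have [s ->] := weyl_conj_weyl_ex S d r kl.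
  by rewrite tpermR tpermD // 1?eq_sym //; apply: lineStab_weyl; rewrite // eq_sym.
have wkl : lineStab (w k l) by apply: (lineStab_weyl false).
have [dr|dr] := eqVneq d r.
  by rewrite dr tpermD // weyl_id // invg1 mul1g mulg1.
have d'r : tperm k l d != r.
  by rewrite -{1}(@tpermD _ k l r) // (inj_eq perm_inj).
have [s wE] := weyl_conj_weyl_ex S l k dr.
rewrite tpermC (@tpermD _ k l r) // in wE.
have -> : (w k l * w d r = signed s (w (tperm k l d) r) * w k l)%g.
  by rewrite -wE /conjg weylVE // -!mulgA -[w l k]weylVE // mulVg mulg1.
rewrite mulgA; apply: genM => //; case: s {wE} => /=; last first.
  by rewrite mulVg; apply: gen1.
rewrite -invgM; apply: genV; apply: lineStab_weyl2 => //.
exact: T_tperm.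
Qed.

Lemma lineStab_col g : lineStab g ->
  E g r r != 0 /\ forall k, k != r -> E g k r = 0.
Proof.
elim=> [|a' {}g Aa _ [gr gk]|a' {}g Aa _ [gr gk]].
- by rewrite (ent1 mM) eqxx; split=> // k /negPf kr; rewrite (ent1 mM) kr.
- case: Aa => [[k [l [_ _ kl lr ->]]]|[k [l [_ _ kl ->]]]].
    by split=> [|j jr]; rewrite (ent_xM mM mx) // (gk _ lr) if_same addr0 //; apply: gk.
  have lk : l != k by dneq.
  split=> [|j jr]; rewrite expg2 -mulgA !(ent_weylM mM mx) // !eqxx (negPf lk).
    by case: (eqVneq r k) => [<-|_]; last case: (eqVneq r l) => [<-|_]; rewrite
      ?oppr_eq0.
  by case: (eqVneq j k) => [<-|_]; last case: (eqVneq j l) => [<-|_]; rewrite gk ?oppr0.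
- case: Aa => [[k [l [_ _ kl lr ->]]]|[k [l [_ _ kl ->]]]].
    by split=> [|j jr]; rewrite (ent_xVM mM mx) // (gk _ lr) if_same subr0 //;
      apply: gk.
  have lk : l != k by dneq.
  rewrite expg2 invgM !weylVE //.
  split=> [|j jr]; rewrite -mulgA !(ent_weylM mM mx) // !eqxx (negPf kl).
    by case: (eqVneq r l) => [<-|_]; last case: (eqVneq r k) => [<-|_]; rewrite
      ?oppr_eq0.
  by case: (eqVneq j l) => [<-|_]; last case: (eqVneq j k) => [<-|_]; rewrite gk ?oppr0.
Qed.

Lemma onAxis_col d g : onAxis d g ->
  E g d r != 0 /\ forall k, k != d -> E g k r = 0.
Proof.
move=> Og; have [gr gk] := lineStab_col Og.
rewrite -[g](mulVKg (w d r)); move: (_ * g)%g gr gk => h hr hk.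
have [->|dr] := eqVneq d r; first by rewrite weyl_id // mul1g.
split=> [|k kd]; rewrite (ent_weylM mM mx) // ?eqxx // (negPf kd).
by case: eqP => [_|/eqP/hk //]; rewrite hk ?oppr0.
Qed.

Lemma onAxis_gen2 d i j A g : T d -> T i -> T j -> i != j -> i != d -> j != d ->
  gen2 x i j A -> onAxis d g -> onAxis d (A * g)%g.
Proof.
move=> Td Ti Tj ij id jd; have ji : j != i by dneq.
apply: gen_act => _ h [->|->].
- exact: (@onAxis_x _ false).
- exact: (@onAxis_x _ false).
- exact: (@onAxis_x _ true).
- exact: (@onAxis_x _ true).
Qed.

Lemma onAxis_weylX d k l s g : T d -> T k -> T l -> k != l ->
  onAxis d g -> onAxis d (w k l ^+ (s * 2) * g)%g.
Proof.
move=> Td Tk Tl kl Og; elim: s => [|s IH]; first by rewrite mul1g.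
rewrite mulSn expgnDr expg2 -!mulgA -(tpermK k l d).
by apply: onAxis_weyl; rewrite ?T_tperm //; apply: onAxis_weyl.
Qed.

(** The known elements g with g e_r in the plane of e_i and e_j. *)
Definition inPlane i j g :=
  exists B o, [/\ gen2 x i j B, onAxis i o & g = (B * o)%g].

(** The set attached to the index d: g e_r is reached from the axis of d by a
    motion in the plane of d and e, followed by one in the plane of e and f. *)
Definition viaPlane d e f g :=
  exists A B o, [/\ gen2 x e f A, gen2 x d e B, onAxis d o & g = (A * (B * o))%g].

(** An element for two indices whose matrix preserves the axis of i is, by
    [gen2_stab], a product of elements known to preserve it. *)
Lemma gen2_onAxis i j B o : T i -> T j -> i != j ->
  gen2 x i j B -> E B j i = 0 -> onAxis i o -> onAxis i (B * o)%g.
Proof.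
move=> Ti Tj ij AB B0 Oo; have ji : j != i by dneq.
have [k [u [ux ->]]] := gen2_stab S mM mx ij AB B0.
rewrite -mulgA; apply: onAxis_weylX => //.
elim: ux o Oo => [|_ u' <- _ IH|_ u' <- _ IH] o Oo; first by rewrite mul1g.
  by rewrite -mulgA; apply: (@onAxis_x _ false) => //; apply: IH.
by rewrite -mulgA; apply: (@onAxis_x _ true) => //; apply: IH.
Qed.

Lemma gen2_onAxis_swap i j B o : T i -> T j -> i != j ->
  gen2 x i j B -> E B i i = 0 -> onAxis i o -> onAxis j (B * o)%g.
Proof.
move=> Ti Tj ij AB B0 Oo; have ji : j != i by dneq.
rewrite -(tpermR j i) -[(B * o)%g](mulKg (w i j)) weylVE //.
apply: onAxis_weyl => //; rewrite mulgA; apply: (gen2_onAxis Ti Tj ij) => //.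
  by apply: genM => //; apply: gen2_weyl.
by rewrite (ent_weylM mM mx) // (negPf ji) eqxx B0 oppr0.
Qed.

Lemma inPlane_sym i j g : T i -> T j -> i != j -> inPlane i j g -> inPlane j i g.
Proof.
move=> Ti Tj ij [B [o [AB Oo ->]]].
exists (B * w i j)%g, (w j i * o)%g; split.
- by apply: gen2_sym; apply: genM => //; apply: gen2_weyl.
- by rewrite -{1}(tpermR j i); apply: onAxis_weyl => //; dneq.
- by rewrite -(weylVE S i j) !mulgA mulgK.
Qed.

(** The order of the two other indices is immaterial, since w_fe exchanges the
    planes (d, e) and (d, f) and lies in the group of e and f. *)
Lemma viaPlane_sym d e f g : tri d e f -> viaPlane d e f g -> viaPlane d f e g.
Proof.
move=> [de ef df [Td Te Tf]] [A [B [o [AA AB Oo ->]]]].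
exists (A * w e f)%g, (B ^ w e f)%g, (w f e * o)%g; split.
- by apply: gen2_sym; apply: genM => //; apply: gen2_weyl.
- have := gen2_conj_weyl S e f de AB.
  by rewrite tpermL tpermD // eq_sym.
- rewrite -{1}(@tpermD _ f e d) 1?eq_sym //.
  by apply: onAxis_weyl => //; dneq.
- by rewrite /conjg -(weylVE S e f) !mulgA !gnorm.
Qed.

(** For i = d, the element x_dj first passes through the motion in the plane
    (e, f), which acts on the group of x_de and x_df. There x_de is a motion in
    the plane (d, e), and x_df passes through such a motion as a product of
    elements x_df and x_ef, which preserve the axis of d. *)
Lemma viaPlane_step d e f s i j g : tri d e f -> T i -> T j -> i != j -> j != d ->
  viaPlane d e f g -> viaPlane d e f (signed s (x i j) * g)%g.
Proof.
move=> tdef; have [de ef df [Td Te Tf]] := tdef.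
have ed : e != d by dneq. have fd : f != d by dneq.
move=> Ti Tj ij jd [A [B [o [AA AB Oo ->]]]].
have [id|id] := eqVneq i d; last first.
  exists (signed s (x i j) * A)%g, B, o; split; rewrite ?mulgA //.
  apply: genM => //; apply: gen_signed; move: ij id jd.
  by case: (tri_mem tdef Ti) (tri_mem tdef Tj) => -> [] ->;
    rewrite ?eqxx // => _ _ _; [left | right].
rewrite {i Ti}id in ij *.
pose V h := exists B o, [/\ gen2 x d e B, onAxis d o & h = (B * o)%g].
suff Vx u h : gen (fun g => g = x d e \/ g = x d f) u -> V h -> V (u * h)%g.
  have rowA : gen (fun g => g = x d e \/ g = x d f) (signed s (x d j) ^ A)%g.
    apply: row_conj => //; apply: gen_signed; move: ij jd.
    by case: (tri_mem tdef Tj) => ->; rewrite ?eqxx // => _ _; [left | right].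
  have [|B' [o' [AB' Oo' hE]]] := Vx _ (B * o)%g rowA; first by exists B, o.
  by exists A, B', o'; split; rewrite // -hE /conjg !mulgA !gnorm.
have Vs t j' h' : j' = e \/ j' = f -> V h' -> V (signed t (x d j') * h')%g.
  move=> [->|->] [B' [o' [AB' Oo' ->]]].
    exists (signed t (x d e) * B')%g, o'; split; rewrite ?mulgA //.
    by apply: genM => //; apply: gen_signed; left.
  exists B', (signed t (x d f) ^ B' * o')%g; split; first by [].
    have : gen (fun h => h = x d f \/ h = x e f) (signed t (x d f) ^ B')%g.
      by apply: col_conj => //; apply: gen_signed; left.
    move=> U; apply: gen_act U Oo' => _ h2 [->|->] Oh.
    - exact: (@onAxis_x _ false).
    - exact: (@onAxis_x _ false).
    - exact: (@onAxis_x _ true).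
    - exact: (@onAxis_x _ true).
  by rewrite /conjg !mulgA !gnorm.
apply: gen_act => _ h' [->|->] Vh.
- by apply: (Vs false) => //; left.
- by apply: (Vs false) => //; right.
- by apply: (Vs true) => //; left.
- by apply: (Vs true) => //; right.
Qed.

Definition allPlanes d g := exists e f, tri d e f /\ viaPlane d e f g.

Lemma allPlanesE d e f g : tri d e f -> allPlanes d g -> viaPlane d e f g.
Proof.
move=> tdef [e' [f' [tdef' Lg]]].
have [de' ef' df' [_ Te' Tf']] := tdef'.
move: tdef' Lg de' ef' df'.
case: (tri_mem tdef Te') (tri_mem tdef Tf') => -> [] -> tdef' Lg;
  rewrite ?eqxx // => _ _ _.
exact: viaPlane_sym.
Qed.

Lemma inPlane_viaPlane i j k d g : tri i j k -> T d -> inPlane i j g ->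
  allPlanes d g.
Proof.
move=> tijk Td Zg; have [ij jk ik [Ti Tj Tk]] := tijk.
have ji : j != i by dneq.
case: (tri_mem tijk Td) => ->.
- exists j, k; split=> //; have [B [o [AB Oo ->]]] := Zg.
  by exists 1%g, B, o; split; rewrite ?mul1g //; apply: gen1.
- exists i, k; split; first exact/tri_swap/tri_rot.
  have [B [o [AB Oo ->]]] := inPlane_sym Ti Tj ij Zg.
  by exists 1%g, B, o; split; rewrite ?mul1g //; apply: gen1.
- exists i, j; split; first by do 2 apply: tri_rot.
  have [B [o [AB Oo ->]]] := Zg.
  exists B, (w k i)^-1%g, (w k i * o)%g; split=> //.
  + by apply: genV; apply: gen2_weyl.
  + by rewrite -{1}(tpermR k i); apply: onAxis_weyl => //; dneq.
  + by rewrite mulKg.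
Qed.

(** The second motion fixes the k-th coordinate; as this coordinate vanishes,
    the first motion has led from the axis of k to that of i. *)
Lemma viaPlane_opp i j k g : tri i j k -> E g k r = 0 ->
  viaPlane k i j g -> inPlane i j g.
Proof.
move=> [ij jk ik [Ti Tj Tk]] g0 [A [B [o [AA AB Oo gE]]]].
have [od ok] := onAxis_col Oo; have ki : k != i by dneq.
exists A, (B * o)%g; split=> //; apply: (gen2_onAxis_swap Tk Ti ki AB _ Oo).
move: g0; rewrite gE (gen2_row _ _ ij AA) //; try dneq.
rewrite (gen2_mul _ _ ki AB); last by left.
rewrite (ok i) // mulr0 addr0 => /eqP.
by rewrite mulf_eq0 (negPf od) orbF => /eqP.
Qed.

(** Here the second motion, in the plane (i, k), acts on the vector through its
    i-th coordinate, and the result has no k-th coordinate. So either this i-th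
    coordinate was zero already, or the motion maps the axis of i to itself. *)
Lemma viaPlane_side i j k g : tri i j k -> E g k r = 0 ->
  viaPlane j i k g -> inPlane i j g.
Proof.
move=> [ij jk ik [Ti Tj Tk]] g0 [A [B [o [AA AB Oo gE]]]].
have [od ok] := onAxis_col Oo; have ki : k != i by dneq.
have ji : j != i by dneq. have kj : k != j by dneq.
apply: inPlane_sym => //.
have Bk : E (B * o)%g k r = 0 by rewrite (gen2_row _ _ ji AB) // ok.
have : E A k i * E (B * o)%g i r = 0.
  move: g0; rewrite gE (gen2_mul _ _ ik AA); last by right.
  by rewrite Bk mulr0 addr0.
move/eqP; rewrite mulf_eq0 => /orP[]/eqP.
  (* The motion is w_ik^(2 s) u with u a power of x_ik; both factors are moved
     to the right of B, where they preserve the axis of j. *)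
  move=> A0; have [s [u [ux AE]]] := gen2_stab S mM mx ik AA A0.
  have UB : gen (fun h => h = x j k \/ h = x i k) (u ^ B)%g.
    by apply: col_conj => //; apply: gen_mono ux => _ <-; right.
  exists (B ^ (w i k ^- (s * 2)))%g, (w i k ^+ (s * 2) * (u ^ B * o))%g; split.
  - by rewrite -expVgn weylVE //; apply: gen2_conj_weylX.
  - apply: onAxis_weylX => //.
    apply: (gen_act _ _ UB Oo) => _ h [->|->].
    + exact: (@onAxis_x _ false).
    + exact: (@onAxis_x _ false).
    + exact: (@onAxis_x _ true).
    + exact: (@onAxis_x _ true).
  - by rewrite gE AE /conjg !invgK !mulgA !gnorm.
rewrite (gen2_mul _ _ ji AB); last by right.
rewrite (ok i) // mulr0 addr0 => /eqP.
rewrite mulf_eq0 (negPf od) orbF => /eqP B0.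
have OBo : onAxis j (B * o)%g by apply: (gen2_onAxis Tj Ti ji AB).
exists 1%g, g; split; rewrite ?mul1g //; first exact: gen1.
by rewrite gE; apply: (onAxis_gen2 Tj Ti Tk ik).
Qed.

Lemma allPlanes_step d s i j g : T d -> T i -> T j -> i != j -> d != j ->
  allPlanes d g -> allPlanes d (signed s (x i j) * g)%g.
Proof.
move=> Td Ti Tj ij dj [e [f [tdef Lg]]]; exists e, f; split=> //.
by apply: viaPlane_step => //; dneq.
Qed.

(** The sets attached to the three indices coincide. With i the position of a
    largest entry, the descent along x_ij connects the sets of all indices but
    j, and the descent along x_ik those of all indices but k. *)
Lemma allPlanes_all N d d' g : (height T r g < N)%N -> T d -> T d' ->
  allPlanes d g -> allPlanes d' g.
Proof.
elim: N d d' g => // N IH d d' g ltN Td Td' Lg.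
have planar i j k : tri i j k -> E g k r = 0 -> inPlane i j g.
  move=> tijk g0; have [ij jk ik [Ti Tj Tk]] := tijk.
  have tjik : tri j i k by apply: tri_swap; apply: tri_rot.
  case: (tri_mem tijk Td) Lg => -> Lg.
  - apply: inPlane_sym => //; first by dneq.
    by apply: (viaPlane_side tjik g0); apply: allPlanesE Lg.
  - by apply: (viaPlane_side tijk g0); apply: allPlanesE Lg.
  - apply: (viaPlane_opp tijk g0); apply: allPlanesE Lg.
    by do 2 apply: tri_rot.
have descend i y e e' : T i -> T y -> T e -> T e' -> i != y -> E g y r != 0 ->
    `|E g y r| <= `|E g i r| -> e != y -> e' != y ->
    allPlanes e g -> allPlanes e' g.
  move=> Ti Ty Te Te' iy y0 leyi ey e'y Lge.
  have [s lts] := height_descent Ti iy y0 leyi.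
  rewrite -[g](mulKg (signed s (x i y))) -signedV; apply: allPlanes_step => //.
  apply: (IH e) => //; first exact: leq_trans lts _.
  exact: allPlanes_step.
have [i [j [k [tijk ij_max ik_max]]]] : exists i j k, [/\ tri i j k,
    `|E g j r| <= `|E g i r| & `|E g k r| <= `|E g i r|].
  have tabc : tri a b c by split=> //; split; rewrite /= eqxx ?orbT.
  have [ab_|/ltW ab_] := leP `|E g b r| `|E g a r|.
    have [ac_|/ltW ac_] := leP `|E g c r| `|E g a r|; first by exists a, b, c.
    by exists c, a, b; split; [do 2 apply: tri_rot | | apply: le_trans ac_].
  have [bc_|/ltW bc_] := leP `|E g c r| `|E g b r|.
    by exists b, c, a; split=> //; apply: tri_rot.
  by exists c, a, b; split; [do 2 apply: tri_rot | apply: le_trans bc_ |].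
have [ij jk ik [Ti Tj Tk]] := tijk.
have [j0|j0] := eqVneq (E g j r) 0.
  by apply: (inPlane_viaPlane (tri_swap tijk) Td'); exact: (planar _ _ _ (tri_swap
    tijk) j0).
have [k0|k0] := eqVneq (E g k r) 0.
  by apply: (inPlane_viaPlane tijk Td'); exact: (planar _ _ _ tijk k0).
have Li : allPlanes i g.
  have [dj|dj] := eqVneq d j.
    by apply: (descend i k d i) => //; rewrite dj.
  exact: (descend i j d i).
have [d'j|d'j] := eqVneq d' j.
  by apply: (descend i k i d') => //; rewrite d'j.
exact: (descend i j i d').
Qed.

Local Notation vecStab := (colStab x T r).

(** The line stabiliser contains the vector stabiliser with index at most 2, so
    the sign can be moved into the group of r and e. *)
Lemma lineStab_split e f g : tri r e f -> lineStab g ->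
  vecStab g \/ vecStab ((w r e ^+ 2)^-1 * g)%g.
Proof.
move=> [re ef rf [_ Te Tf]]; set h := (w r e ^+ 2)%g.
have er : e != r by dneq. have fr : f != r by dneq. have fe : f != e by dneq.
have hV : h^-1%g = h.
  by apply: (mulgI h); rewrite mulgV -expgnDr weyl_order.
pose Y u := vecStab u \/ vecStab (h^-1 * u)%g.
have Yh u : Y u -> Y (h * u)%g.
  by case=> Yu; [right; rewrite mulKg | left; rewrite -hV].
have stab_h u : vecStab u -> vecStab (u ^ h)%g.
  apply: gen_conj1 => _ [k [l [Tk Tl kl lr ->]]].
  rewrite /h expg2 conjgM; have [s ->] := weyl_conj_ex S r e kl.
  have kl' : tperm r e k != tperm r e l by rewrite (inj_eq perm_inj).
  rewrite signed_conj; have [s' ->] := weyl_conj_ex S r e kl'.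
  by rewrite !tpermK signed_add; apply: gen_signed; exists k, l.
have YP p u : vecStab p -> Y u -> Y (p * u)%g.
  move=> Pp [Yu|Yu]; [left; exact: genM | right].
  by rewrite mulg_conj; apply: genM => //; apply: stab_h.
have stab_w k l : T k -> T l -> k != l -> k != r -> l != r -> vecStab (w k l).
  move=> Tk Tl kl kr lr; have lk : l != k by dneq.
  rewrite weylE; apply: genM; first by apply: gen_sub; exists k, l.
  by apply: genM; [apply: gen_subV | apply: gen_sub]; [exists l, k | exists k, l].
have Yr k u : T k -> r != k -> Y u -> Y (w r k ^+ 2 * u)%g.
  move=> Tk rk Yu; have : [\/ k = r, k = e | k = f] by apply: tri_mem.
  case=> kE; rewrite kE ?eqxx // in rk *; first exact: Yh.
  (* The square of w_rf is the conjugate of h by w_ef, which fixes e_r. *)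
  have -> : (w r f ^+ 2 * u = w e f * (h * ((w e f)^-1 * u)))%g.
    have <- : ((w r e ^ (w e f)^-1)^-1 = w r f)%g.
      rewrite (weyl_conj_weyl S) // eqxx tpermL (negPf re) /= invgK.
      by rewrite tpermD; dneq.
    by rewrite expVgn -conjXg -/h -conjVg hV /conjg invgK !mulgA.
  apply: (YP _ _ (stab_w _ _ Te Tf ef er fr)); apply: Yh; rewrite weylVE //.
  exact: (YP _ _ (stab_w _ _ Tf Te fe fr er)).
have Yw k l u : T k -> T l -> k != l -> Y u -> Y (w k l ^+ 2 * u)%g.
  move=> Tk Tl kl Yu; have lk : l != k by dneq.
  have [kr|kr] := eqVneq k r; first by rewrite kr in kl *; apply: Yr.
  have [lr|lr] := eqVneq l r.
    rewrite lr in lk *; have -> : (w k r ^+ 2 = w r k ^+ 2)%g; last exact: Yr.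
    rewrite -weylVE // expVgn; apply: (mulgI (w r k ^+ 2)%g).
    by rewrite mulgV -expgnDr weyl_order.
  by apply: YP => //; apply: genX; apply: stab_w.
move=> Pg; rewrite -/(Y g) -[g]mulg1.
have Y1 : Y 1%g by left; apply: gen1.
apply: (gen_act _ _ Pg Y1) => _ u [[k [l [Tk Tl kl lr ->]]]|[k [l [Tk Tl kl ->]]]].
- by apply: YP; apply: gen_sub; exists k, l.
- exact: Yw.
- by apply: YP; apply: gen_subV; exists k, l.
- by rewrite -expVgn weylVE //; apply: Yw => //; dneq.
Qed.

(** The sets of the three indices being equal, each of them is stable under all
    generators, and therefore contains the whole group. *)
Lemma SL3_decomp e f g : tri r e f ->
    gamma x T g ->
  exists A B p, [/\ gen2 x e f A, gen2 x r e B, vecStab p &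
    g = (A * (B * p))%g].
Proof.
move=> tref Gg; have [re ef rf [_ Te Tf]] := tref.
have all_g : forall d, T d -> allPlanes d g.
  have step s i j u : T i -> T j -> i != j -> (forall d, T d -> allPlanes d u) ->
      forall d, T d -> allPlanes d (signed s (x i j) * u)%g.
    move=> Ti Tj ij Lu d Td; apply: (allPlanes_all (ltnSn _) Ti) => //.
    by apply: allPlanes_step => //; apply: Lu.
  rewrite -[g]mulg1; apply: (gen_act (E := fun u => forall d, T d -> allPlanes d u)
    _ _ Gg).
  - by move=> _ u [i [j [Ti Tj ij ->]]]; apply: (step false).
  - by move=> _ u [i [j [Ti Tj ij ->]]]; apply: (step true).
  move=> d Td; apply: (inPlane_viaPlane tref) => //; exists 1%g, 1%g.
  split; rewrite ?mulg1 //; try exact: gen1.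
  by rewrite /onAxis weyl_id // invg1 mulg1; apply: gen1.
have [A [B [o [AA AB Oo ->]]]] := allPlanesE tref (all_g r Tr).
move: Oo; rewrite /onAxis weyl_id // invg1 mul1g => Oo.
have [Po|Po] := lineStab_split tref Oo; first by exists A, B, o.
exists A, (B * w r e ^+ 2)%g, ((w r e ^+ 2)^-1 * o)%g; split=> //.
  by apply: genM => //; apply: genX; apply: gen2_weyl.
by rewrite -(mulgA B) mulVKg.
Qed.

End SL3.

(** * More indices, and injectivity *)

Section Chain.
Local Open Scope ring_scope.
Variables (n : nat) (K : groupType) (x : 'I_n -> 'I_n -> K).
Variable m : K -> SL n int.
Hypothesis S : steinberg x.
Hypothesis mM : {morph m : g h / (g * h)%g}.
Hypothesis mx : forall i j, m (x i j) = elem i j.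
Implicit Types i j k l o p q r : 'I_n.
Local Notation E g := (SLmx (m g)).
Local Notation w := (weyl x).

Definition itv lo hi := [pred k : 'I_n | (lo <= k < hi)%N].

Lemma gamma_mono (D D' : pred 'I_n) g : (forall i, D i -> D' i) ->
  gamma x D g -> gamma x D' g.
Proof.
by move=> DD'; apply: gen_mono => _ [i [j [Di Dj ij ->]]];
  exists i, j; split=> //; apply: DD'.
Qed.

Lemma gamma_gen2 (D : pred 'I_n) i j g : D i -> D j -> i != j ->
  gen2 x i j g -> gamma x D g.
Proof.
move=> Di Dj ij; apply: gen_mono => _ [->|->]; first by exists i, j.
by exists j, i; split=> //; dneq.
Qed.

Lemma colStab_mono (D D' : pred 'I_n) r g : (forall i, D i -> D' i) ->
  colStab x D r g -> colStab x D' r g.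
Proof.
by move=> DD'; apply: gen_mono => _ [i [j [Di Dj ij jr ->]]];
  exists i, j; split=> //; apply: DD'.
Qed.

Lemma x_commutator i j k : i != j -> j != k -> i != k ->
  x i k = (x i j * (x j k * ((x i j)^-1 * (x j k)^-1)))%g.
Proof.
by move=> ij jk ik; rewrite mulgA (st_chain S ij jk ik) !mulgA !gnorm.
Qed.

Definition preserves (F : K -> Prop) u :=
  (forall h, F h -> F (u * h)%g) /\ (forall h, F h -> F (u^-1 * h)%g).

Lemma preserves_commutator F i j k : i != j -> j != k -> i != k ->
  preserves F (x i j) -> preserves F (x j k) -> preserves F (x i k).
Proof.
move=> ij jk ik [F1 F1V] [F2 F2V]; rewrite (x_commutator ij jk ik).
split=> h Fh; rewrite ?invgM ?invgK -!mulgA.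
  by apply: F1; apply: F2; apply: F1V; apply: F2V.
by apply: F2; apply: F1; apply: F2V; apply: F1V.
Qed.

Section Step.
Variables r o p q : 'I_n.
Hypotheses (ro : (r < o)%N) (op : p = o.+1 :> nat) (pq : q = p.+1 :> nat).

Let op' : o != p. Proof. oneq. Qed.
Let pq' : p != q. Proof. oneq. Qed.
Let oq' : o != q. Proof. oneq. Qed.

(** A group in the stabiliser of e_r, normalised by the elements for the indices
    before p. *)
Definition lastCols := gen (fun g =>
  exists i j, [/\ itv r q.+1 i, j = p \/ j = q, i != j & g = x i j]).

Lemma lastCols_conj u g : lastCols u -> gamma x (itv r p) g ->
  lastCols (u ^ g).
Proof.
apply: gen_conj => _ _ [i [j [Di jE ij ->]]] [k [l [/= Dk Dl kl ->]]].
have [jk jl] : j != k /\ j != l.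
  by case: jE => ->; split; oneq.
have xij : lastCols (x i j) by apply: gen_sub; exists i, j.
have [il|il] := eqVneq i l; last by rewrite (st_conj S) // (st_conjV S).
have kj : k != j by dneq.
have xkj : lastCols (x k j).
  by apply: gen_sub; exists k, j; split=> //; rewrite /=; lia.
rewrite il in ij xij *.
rewrite (st_conjl S kl ij kj) (st_conjlV S kl ij kj).
by split; apply: genM => //; apply: genV.
Qed.

Lemma lastCols_stab u : lastCols u -> colStab x (itv r q.+1) r u.
Proof.
apply: gen_mono => _ [i [j [Di jE ij ->]]]; exists i, j; split=> //.
  by case: jE => ->; rewrite /=; lia.
by case: jE => ->; oneq.
Qed.

(** Stability under the generators for o and p uses the decomposition twice:
    the middle factor B is decomposed with o, p in place of p, q, the resulting
    product for the three indices o, p, q is decomposed by [SL3_decomp], and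
    its last factor is moved through the elements for the indices before p by
    [lastCols_conj]. *)
Lemma chain_step :
    (forall g, gamma x (itv r p.+1) g -> exists A B s, [/\ gen2 x o p A,
       gamma x (itv r p) B, colStab x (itv r p.+1) r s & g = (A * (B * s))%g]) ->
  forall g, gamma x (itv r q.+1) g -> exists A B s, [/\ gen2 x p q A,
    gamma x (itv r q) B, colStab x (itv r q.+1) r s & g = (A * (B * s))%g].
Proof.
move=> IH g Gg.
pose F h := exists A B s, [/\ gen2 x p q A, gamma x (itv r q) B,
  colStab x (itv r q.+1) r s & h = (A * (B * s))%g].
rewrite -/(F g).
have F_pq u h : gen2 x p q u -> F h -> F (u * h)%g.
  move=> Au [A [B [s [AA GB Ps ->]]]]; exists (u * A)%g, B, s.
  by split; rewrite ?mulgA //; apply: genM.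
have F_rp u h : gamma x (itv r p) u -> F h -> F (u * h)%g.
  move=> Gu [A [B [s [AA GB Ps ->]]]]; exists A, (u * B)%g, s; split=> //.
    apply: genM => //; apply: gamma_mono Gu => i /=; lia.
  have cuA : (u * A = A * u)%g.
    apply: gen_commute Gu AA => _ _ [i [j [/= Di Dj ij ->]]] [->|->];
      by apply: (st_comm S) => //; oneq.
  by rewrite !mulgA cuA.
have F_op u h : gen2 x o p u -> F h -> F (u * h)%g.
  move=> Au [A [B [s [AA GB Ps ->]]]].
  have [|A' [B' [s' [AA' GB' Ps' ->]]]] := IH B.
    by apply: gamma_mono GB => i /=; lia.
  have Gop : gamma x (T3 o p q) (u * A * A')%g.
    do 2?apply: genM; [apply: gamma_gen2 Au | apply: gamma_gen2 AA |
      apply: gamma_gen2 AA'] => //=; rewrite ?eqxx ?orbT //.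
  have To : T3 o p q o by rewrite /= eqxx.
  have tri_opq : tri o p q o p q by split=> //; split; rewrite /= eqxx ?orbT.
  have [A2 [B2 [s2 [AA2 AB2 Ps2 uE]]]] := SL3_decomp S mM mx op' pq' oq' To tri_opq Gop.
  exists A2, (B2 * B')%g, (s2 ^ B' * (s' * s))%g; split=> //.
  - apply: genM; first by apply: gamma_gen2 AB2 => //=; lia.
    by apply: gamma_mono GB' => i /=; lia.
  - apply: genM; last apply: genM => //.
      apply: lastCols_stab; apply: lastCols_conj GB'.
      apply: gen_mono Ps2 => _ [i [j [Ti Tj ij jo ->]]]; exists i, j; split=> //.
        by move: Ti => /or3P[]/eqP->; rewrite /=; lia.
      move: Tj; rewrite /= (negPf jo) /= => /orP[]/eqP->; [by left | by right].
    by apply: colStab_mono Ps' => i /=; lia.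
  - have -> : (u * (A * (A' * (B' * s') * s)) = (u * A * A') * (B' * (s' * s)))%g.
      by rewrite !mulgA.
    by rewrite uE /conjg !mulgA !gnorm.
have presV u (D : K -> Prop) : (forall v h, gen D v -> F h -> F (v * h)%g) ->
    D u -> preserves F u.
  by move=> FD Du; split=> h; apply: FD; [apply: gen_sub | apply: gen_subV].
have pres_pq : preserves F (x p q) by apply: presV F_pq _; left.
have pres_qp : preserves F (x q p) by apply: presV F_pq _; right.
have pres_op : preserves F (x o p) by apply: presV F_op _; left.
have pres_po : preserves F (x p o) by apply: presV F_op _; right.
have pres_rp i j : itv r p i -> itv r p j -> i != j -> preserves F (x i j).
  by move=> Di Dj ij; apply: presV F_rp _; exists i, j.
have pres_p i : itv r p i -> preserves F (x i p) /\ preserves F (x p i).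
  move=> /= Di; have [->|io] := eqVneq i o; first by [].
  have [ip oi po] : [/\ i != p, o != i & p != o].
    by split; [oneq | rewrite eq_sym | rewrite eq_sym].
  have Do : itv r p o by rewrite /=; lia.
  split; first by apply: (@preserves_commutator _ i o p) => //; apply: pres_rp.
  by apply: (@preserves_commutator _ p o i) => //; [dneq | apply: pres_rp].
have pres_q i : itv r p i -> preserves F (x i q) /\ preserves F (x q i).
  move=> Di; have [ip pi] := pres_p i Di; move: Di => /= Di.
  have [ip' iq' qp'] : [/\ i != p, i != q & q != p] by split; oneq.
  split; first by apply: (@preserves_commutator _ i p q).
  by apply: (@preserves_commutator _ q p i) => //; dneq.
have pres i j : itv r q.+1 i -> itv r q.+1 j -> i != j -> preserves F (x i j).
  have split_q k : itv r q.+1 k -> [\/ itv r p k, k = p | k = q].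
    move=> /= Dk; have [kp|kp] := boolP (k < p)%N.
      by apply: Or31; rewrite /=; lia.
    have [->|kq] := eqVneq k p; [exact: Or32 | apply: Or33].
    by apply/val_inj; move: kq => /=; rewrite -val_eqE /=; lia.
  move=> /split_q[Di|->|->] /split_q[Dj|->|->]; rewrite ?eqxx // => ij.
  - exact: pres_rp.
  - by case: (pres_p i Di).
  - by case: (pres_q i Di).
  - by case: (pres_p j Dj).
  - by case: (pres_q j Dj).
rewrite -[g]mulg1; apply: (gen_act _ _ Gg).
- by move=> _ h [i [j [Di Dj ij ->]]] Fh; case: (pres i j Di Dj ij) => H _; apply: H.
- by move=> _ h [i [j [Di Dj ij ->]]] Fh; case: (pres i j Di Dj ij) => _ H; apply: H.
by exists 1%g, 1%g, 1%g; split; rewrite ?mulg1 //; apply: gen1.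
Qed.

End Step.

Lemma chain_decomp r o p g : (r < o)%N -> p = o.+1 :> nat ->
  gamma x (itv r p.+1) g -> exists A B s, [/\ gen2 x o p A,
    gamma x (itv r p) B, colStab x (itv r p.+1) r s & g = (A * (B * s))%g].
Proof.
move: {2}(o - r)%N (leqnn (o - r)) => N; elim: N o p g => [|N IH] o p g leN ro po.
  by move: leN ro; lia.
have op' : o != p by oneq.
have [ro1|ro1] := eqVneq (o : nat) r.+1; last first.
  have o1n : (o.-1 < n)%N by have := ltn_ord o; lia.
  have ro' : (r < Ordinal o1n)%N by move: ro1 ro => /=; lia.
  have oo' : o = (Ordinal o1n).+1 :> nat by rewrite /=; lia.
  apply: (chain_step ro' oo' po) => {}g Gg.
  by apply: IH => //=; lia.
have ro' : r != o by oneq. have rp : r != p by oneq.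
move=> Gg.
have Tr : T3 r o p r by rewrite /= eqxx.
have tri_rop : tri r o p r o p by split=> //; split; rewrite /= eqxx ?orbT.
have T3E i : itv r p.+1 i = T3 r o p i.
  by rewrite /= -!val_eqE /=; lia.
have GT : gamma x (T3 r o p) g by apply: gamma_mono Gg => i; rewrite T3E.
have [A [B [s [AA AB Ps ->]]]] := SL3_decomp S mM mx ro' op' rp Tr tri_rop GT.
exists A, B, s; split=> //.
  by apply: gamma_gen2 AB => //=; lia.
by apply: colStab_mono Ps => i; rewrite T3E.
Qed.

Lemma colStab_col D r g : colStab x D r g -> forall k, E g k r = (k == r)%:R.
Proof.
elim=> [|_ {}g [i [j [_ _ ij jr ->]]] _ IH|_ {}g [i [j [_ _ ij jr ->]]] _ IH] k.
- by rewrite (ent1 mM).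
- by rewrite (ent_xM mM mx) // !IH (negPf jr) if_same addr0.
- by rewrite (ent_xVM mM mx) // !IH (negPf jr) if_same subr0.
Qed.

(** Here the relation w_ij^4 = 1 is used: w_ij^2 maps e_i to - e_i, so that an
    even power of w_ij fixing e_i is a power of w_ij^4. *)
Lemma weyl_even_one i j (k : nat) u : i != j -> gen (eq (x i j)) u ->
  E (w i j ^+ (k * 2) * u)%g i i = 1 -> (w i j ^+ (k * 2) = 1)%g.
Proof.
move=> ij ux; have ji : j != i by dneq.
have -> : E (w i j ^+ (k * 2) * u)%g i i = (-1) ^+ k.
  elim: k => [|k IH].
    by rewrite mul1g; have [->] := col_genX mM mx ij ux.
  rewrite mulSn expgnDr expg2 -!mulgA !(ent_weylM mM mx) //.
  by rewrite eqxx (negPf ji) eqxx IH exprS mulN1r.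
move=> k1; have ek : ~~ odd k by move: k1; rewrite -signr_odd; case: odd.
have -> : (k * 2 = 4 * k./2)%N by rewrite -[in LHS](even_halfK ek) -muln2; lia.
by rewrite expgnA weyl_order // expg1n.
Qed.

(** If g = A B s fixes e_r, so does B: the other factors fix e_r, the element A
    because its indices differ from r. So B is known by induction. *)
Lemma chain_stab r p g : (r < p)%N -> gamma x (itv r p.+1) g ->
  (forall k, E g k r = (k == r)%:R) -> colStab x (itv r p.+1) r g.
Proof.
move: {2}(p - r)%N (leqnn (p - r)) => N; elim: N p g => [|N IH] p g leN rp.
  by move: leN rp; lia.
have rp' : r != p by oneq. have pr' : p != r by oneq.
move=> Gg gcol.
have [pr1|pr1] := eqVneq (p : nat) r.+1.
  have Ag : gen2 x r p g.
    apply: gen_mono Gg => _ [i [j [Di Dj ij ->]]].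
    have rp_mem k : itv r p.+1 k -> k = r \/ k = p.
      move=> /= Dk; have [->|kr] := eqVneq k r; [by left | right].
      by apply/val_inj; move: kr => /=; rewrite -val_eqE /=; lia.
    by case: (rp_mem i Di) (rp_mem j Dj) ij => -> [] ->; rewrite ?eqxx //; [left |
      right].
  have [|k [u [ux gE]]] := gen2_stab S mM mx rp' Ag; first by rewrite gcol (negPf pr').
  move: (gcol r); rewrite gE eqxx => /(weyl_even_one rp' ux) ->; rewrite mul1g.
  apply: gen_mono ux => _ <-; exists r, p; split=> //=; lia.
have p1n : (p.-1 < n)%N by have := ltn_ord p; lia.
pose o := Ordinal p1n.
have ro : (r < o)%N by move: pr1 rp => /=; lia.
have po : p = o.+1 :> nat by rewrite /=; lia.
have [or' op'] : o != r /\ o != p by split; oneq.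
have [A [B [s [AA GB Ps gE]]]] := chain_decomp ro po Gg.
have PA : colStab x (itv r p.+1) r A.
  apply: gen_mono AA => _ [->|->]; [exists o, p | exists p, o];
    by split=> //=; rewrite ?(eq_sym p) //; lia.
have scol := colStab_col Ps.
have Bcol k : E B k r = (k == r)%:R.
  have -> : E B k r = E (B * s)%g k r.
    rewrite (entM mM) (bigD1 r) //= big1 ?addr0 ?scol ?eqxx ?mulr1 // => l lr.
    by rewrite scol (negPf lr) mulr0.
  have -> : (B * s = A^-1 * g)%g by rewrite gE mulKg.
  rewrite (entM mM) (bigD1 r) //= big1 => [|l lr]; last by rewrite gcol (negPf lr)
    mulr0.
  rewrite gcol eqxx mulr1 addr0 (gen2_col mM mx k op' (genV AA)) //; dneq.
have PB : colStab x (itv r o.+1) r B.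
  by apply: IH => //; [move: leN => /=; lia | rewrite -po].
rewrite gE; apply: genM => //; apply: genM => //.
by apply: colStab_mono PB => i /=; lia.
Qed.

Lemma power_trivial i j z : i != j -> gen (eq (x i j)) z -> E z i j = 0 -> z = 1%g.
Proof.
move=> ij xz; have ji : j != i by dneq.
suff [k [s ->]] : exists (k : nat) s, z = signed s (x i j ^+ k)%g.
  have [_ ->] : E (signed s (x i j ^+ k)%g) j j = 1 /\
      E (signed s (x i j ^+ k)%g) i j = (-1) ^+ s * k%:R.
    have -> : (signed s (x i j ^+ k) = signed s (x i j) ^+ k)%g.
      by case: s => //=; rewrite expVgn.
    elim: k => [|k [jj ij']].
      by rewrite !(ent1 mM) eqxx (negPf ij) mulr0.
    rewrite expgS !(ent_sxM mM mx) // eqxx (negPf ji) jj ij' addr0; split=> //.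
    by rewrite mulr1 -[k.+1]addn1 natrD mulrDr mulr1.
  move=> /eqP; rewrite mulf_eq0 signr_eq0 /= => /eqP k0.
  have -> : k = 0%N by lia.
  by case: s => /=; rewrite ?invg1.
elim: xz => [|_ {}z <- _ [k [s ->]]|_ {}z <- _ [k [s ->]]].
- by exists 0%N, false.
- case: s => /=; last by exists k.+1, false; rewrite expgS.
  case: k => [|k]; first by exists 1%N, false; rewrite invg1 mulg1.
  by exists k, true; rewrite /= expgSr invgM mulVKg.
- case: s => /=; first by exists k.+1, true; rewrite /= expgSr invgM.
  case: k => [|k]; first by exists 1%N, true; rewrite mulg1.
  by exists k, false; rewrite /= expgS mulKg.
Qed.

Definition rowGroup r t := gen (fun g =>
  exists j, [/\ (j < t)%N, r != j & g = x r j]).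

(** The group of the x_rj is free abelian on them: the exponent of x_rj is the
    matrix entry at (r, j). The columns are treated one after the other. *)
Lemma rowGroup_trivial r t u : rowGroup r t u ->
  (forall j, r != j -> E u r j = 0) -> u = 1%g.
Proof.
elim: t u => [|t IH] u; first by case=> // a g [j []].
move=> Ru u0; have [ok|bad] := boolP [exists j : 'I_n, (j == t :> nat) && (r != j)];
  last first.
  apply: IH => //; apply: gen_mono Ru => _ [j [jt rj ->]].
  exists j; split=> //; rewrite ltn_neqAle -ltnS jt andbT.
  by apply: contra bad => jt'; apply/existsP; exists j; rewrite jt'.
have {ok} [j /andP[/eqP jt rj]] := existsP ok.
have [z [v [xz Rv uE]]] : exists z v,
    [/\ gen (eq (x r j)) z, rowGroup r t v & u = (z * v)%g].
  have comm z l : r != l -> gen (eq (x r j)) z -> (x r l * z = z * x r l)%g.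
    move=> rl xz; apply: (gen_commute _ (gen_sub (erefl (x r l))) xz) => _ _ <- <-.
    have [->//|lj] := eqVneq l j.
    by apply: (st_comm S) => //; dneq.
  elim: Ru {u0} => [|_ {}u [l [lt rl ->]] _ [z [v [xz Rv ->]]]
                   |_ {}u [l [lt rl ->]] _ [z [v [xz Rv ->]]]].
  - by exists 1%g, 1%g; split; rewrite ?mulg1 //; apply: gen1.
  - have [lj|lj] := eqVneq l j.
      exists (x r l * z)%g, v; split; rewrite ?mulgA //.
      by rewrite lj; apply: genMl.
    exists z, (x r l * v)%g; split=> //; last by rewrite !mulgA comm.
    apply: genMl => //; exists l; split=> //.
    by rewrite ltn_neqAle -ltnS lt andbT -jt (inj_eq val_inj).
  - have [lj|lj] := eqVneq l j.
      exists ((x r l)^-1 * z)%g, v; split; rewrite ?mulgA //.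
      by rewrite lj; apply: genVl.
    exists z, ((x r l)^-1 * v)%g; split=> //.
      apply: genVl => //; exists l; split=> //.
      by rewrite ltn_neqAle -ltnS lt andbT -jt (inj_eq val_inj).
    by rewrite !mulgA; congr (_ * _)%g; apply: (mulgI (x r l));
      rewrite mulVKg mulgA comm // mulgK.
have vcol k : E v k j = (k == j)%:R.
  elim: Rv k => [|_ g [l [lt rl ->]] _ IHv|_ g [l [lt rl ->]] _ IHv] k.
  - by rewrite (ent1 mM).
  - have /negPf lj : l != j by oneq.
    by rewrite (ent_xM mM mx) // !IHv lj if_same addr0.
  - have /negPf lj : l != j by oneq.
    by rewrite (ent_xVM mM mx) // !IHv lj if_same subr0.
have z1 : z = 1%g.
  apply: (power_trivial rj xz); rewrite -(u0 j rj) uE (entM mM) (bigD1 j) //=.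
  rewrite vcol eqxx mulr1 big1 ?addr0 // => l lj.
  by rewrite vcol (negPf lj) mulr0.
by rewrite uE z1 mul1g in u0 *; apply: IH.
Qed.

(** The generators x_ij with j != r are the x_rj and those avoiding the index
    r; the group of the former is normalised by the latter. *)
Lemma colStab_split r g : colStab x (itv r n) r g ->
  exists u g', [/\ rowGroup r n u, gamma x (itv r.+1 n) g' & g = (u * g')%g].
Proof.
pose F h := exists u g', [/\ rowGroup r n u, gamma x (itv r.+1 n) g' &
  h = (u * g')%g].
move=> Gg; rewrite -/(F g) -[g]mulg1.
have rowM u h : rowGroup r n u -> F h -> F (u * h)%g.
  move=> Ru [v [g' [Rv Gg' ->]]]; exists (u * v)%g, g'.
  by split; rewrite ?mulgA //; apply: genM.
have lowM v h : gamma x (itv r.+1 n) v -> F h -> F (v * h)%g.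
  move=> Gv [u [g' [Ru Gg' ->]]]; exists (u ^ v^-1)%g, (v * g')%g; split.
  - apply: gen_conj Ru (genV Gv) => _ _ [j [jn rj ->]] [k [l [/= Dk Dl kl ->]]].
    have [rk rl] : r != k /\ r != l by split; oneq.
    have xj : rowGroup r n (x r j) by apply: gen_sub; exists j.
    have xl : rowGroup r n (x r l) by apply: gen_sub; exists l.
    have [jk|jk] := eqVneq j k; last by rewrite (st_conj S) // (st_conjV S).
    rewrite jk in xj *; rewrite (st_conjr S rk kl rl) (st_conjrV S rk kl rl).
    by split; apply: genM => //; apply: genV.
  - exact: genM.
  - by rewrite /conjg invgK !mulgA !gnorm.
have F1 : F 1%g by exists 1%g, 1%g; split; rewrite ?mulg1 //; apply: gen1.
have gens i j : itv r n i -> itv r n j -> i != j -> j != r ->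
    rowGroup r n (x i j) \/ gamma x (itv r.+1 n) (x i j).
  move=> /= Di Dj ij jr; have [->|ir] := eqVneq i r.
    by left; apply: gen_sub; exists j; split; rewrite // eq_sym.
  right; apply: gen_sub; exists i, j; split=> //=.
    by move: ir; rewrite -val_eqE /=; lia.
  by move: jr; rewrite -val_eqE /=; lia.
apply: (gen_act _ _ Gg F1) => _ h [i [j [Di Dj ij jr ->]]] Fh.
  by case: (gens i j Di Dj ij jr) => X; [apply: rowM | apply: lowM].
by case: (gens i j Di Dj ij jr) => X; [apply: rowM | apply: lowM] => //;
  apply: genV.
Qed.

(** Steinberg's relations suffice. If g lies over 1, then so does the factor
    for the indices after r in its splitting, since the other factor only
    changes the row of index r; both factors are thus trivial. *)
Lemma gamma_itv_inj lo g : gamma x (itv lo n) g -> m g = 1%g -> g = 1%g.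
Proof.
move: {2}(n - lo)%N (leqnn (n - lo)) => N; elim: N lo g => [|N IH] lo g leN Gg mg.
  by case: Gg => // a h [i [j [/= Di Dj ij _]]]; lia.
have [lon|lon] := boolP (lo.+1 < n)%N; last first.
  by case: Gg => // a h [i [j [/= Di Dj /eqP ij _]]]; case: ij; apply: val_inj =>
    /=; lia.
have [p1 lo1] : (n.-1 < n)%N /\ (lo < n)%N by lia.
pose r := Ordinal lo1; pose p := Ordinal p1.
have np : n = p.+1 by rewrite /=; lia.
have Ps : colStab x (itv r n) r g.
  apply: (@colStab_mono (itv r p.+1)) => [i /=|]; first by lia.
  apply: chain_stab; first by rewrite /=; lia.
    by apply: gamma_mono Gg => i /=; lia.
  by move=> k; rewrite mg SLmx1.
have [u [g' [Ru Gg' gE]]] := colStab_split Ps.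
have mg'1 : m g' = 1%g.
  apply: SL_ext => k j; rewrite SLmx1; have [->|kr] := eqVneq k r.
    elim: Gg' {gE} => [|_ {}g' [k' [l [/= Dk Dl kl ->]]] _ IHg
                      |_ {}g' [k' [l [/= Dk Dl kl ->]]] _ IHg].
    - by rewrite (ent1 mM).
    - have /negPf rk : r != k' by oneq.
      by rewrite (ent_xM mM mx) // IHg rk addr0.
    - have /negPf rk : r != k' by oneq.
      by rewrite (ent_xVM mM mx) // IHg rk subr0.
  rewrite -SLmx1 -mg gE.
  elim: Ru {gE} => [|_ {}u [l [_ rl ->]] _ IHu|_ {}u [l [_ rl ->]] _ IHu].
  - by rewrite mul1g.
  - by rewrite -mulgA (ent_xM mM mx) // (negPf kr) addr0.
  - by rewrite -mulgA (ent_xVM mM mx) // (negPf kr) subr0.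
have g'1 : g' = 1%g by apply: (IH lo.+1 g' _ Gg' mg'1); lia.
rewrite gE g'1 mulg1 in mg *; apply: (rowGroup_trivial Ru) => j rj.
by rewrite mg SLmx1 (negPf rj).
Qed.

End Chain.

(** * Gaussian elimination *)

Section Generation.
Local Open Scope ring_scope.
Variable n : nat.
Implicit Types (g h : SL n int) (i j k l r y : 'I_n).

Let mM : {morph (fun g : SL n int => g) : g h / (g * h)%g}. Proof. by []. Qed.
Let mx i j : (fun g : SL n int => g) (elem i j) = elem i j. Proof. by []. Qed.
Local Notation Gam := (gamma (@elem n) (itv n 0 n)).

Let itvT i : itv n 0 n i. Proof. by rewrite /= ltn_ord. Qed.

Definition firstCols lo g :=
  forall j, (j < lo)%N -> forall k, SLmx g k j = (k == j)%:R.

Lemma firstCols_x lo s i j g : i != j -> (lo <= j)%N ->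
  firstCols lo g -> firstCols lo (signed s (elem i j) * g)%g.
Proof.
move=> ij loj Cg c clo k; rewrite (ent_sxM mM mx) // Cg //.
rewrite (Cg c clo j) (_ : (j == c) = false) ?mulr0 ?if_same ?addr0 //.
by apply/negbTE; oneq.
Qed.

(** The r-th row of the inverse starts like that of the identity, so the r-th
    column of g is unimodular already below the first r entries. *)
Lemma inv_row r g k : firstCols r g -> (k < r)%N -> SLmx g^-1%g r k = 0.
Proof.
move=> Cg kr; have /negPf rk : r != k by oneq.
have := SLmx1 r k; rewrite rk -(mulVg g) SLmxM (bigD1 k) //=.
rewrite Cg // eqxx mulr1 big1 ?addr0 // => l lk.
by rewrite Cg // (negPf lk) mulr0.
Qed.

Lemma tail_nonzero r g : firstCols r g ->
  exists2 y : 'I_n, (r <= y)%N & SLmx g y r != 0.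
Proof.
move=> Cg.
have : [exists y : 'I_n, (r <= y)%N && (SLmx g y r != 0)].
  apply: contraT => /existsPn none.
  have := SLmx1 r r; rewrite eqxx -(mulVg g) SLmxM big1 // => k _.
  have [rk|kr] := leqP r k; last by rewrite inv_row ?mul0r.
  by have := none k; rewrite rk /= negbK => /eqP ->; rewrite mulr0.
by move=> /existsP[y /andP[ry y0]]; exists y.
Qed.

Lemma tail_unit r y g : firstCols r g ->
  (forall k, k != y -> (r <= k)%N -> SLmx g k r = 0) -> `|SLmx g y r|%N = 1%N.
Proof.
move=> Cg g0; have := SLmx1 r r; rewrite eqxx -(mulVg g) SLmxM (bigD1 y) //=.
rewrite big1 ?addr0 => [|k ky]; last first.
  have [rk|kr] := leqP r k; first by rewrite g0 ?mulr0.
  by rewrite inv_row ?mul0r.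
move=> /(congr1 absz); rewrite abszM => /eqP.
by rewrite muln_eq1 => /andP[_ /eqP].
Qed.

(** In the last column there is no room for changing a sign, but the matrix is
    triangular of determinant 1. *)
Lemma last_diag r g : n = r.+1 -> firstCols r g -> SLmx g r r = 1.
Proof.
move=> nr Cg; rewrite -(SL_det g) -det_tr det_trig.
  rewrite (bigD1 r) //= mxE big1 ?mulr1 // => k kr; rewrite mxE Cg ?eqxx //.
  by have := ltn_ord k; move: kr nr; rewrite -val_eqE /=; lia.
apply/is_trig_mxP => i j ij; rewrite mxE Cg; last first.
  by have := ltn_ord j; move: ij nr => /=; lia.
by rewrite (_ : (j == i) = false) //; apply/negbTE; oneq.
Qed.

(** An entry of index at least r is used to shorten the r-th column as long as
    possible. A shortest column has a single nonzero entry of index at least r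
    that exceeds all others; by unimodularity it is +-1, and the column is a
    signed basis vector. *)
Lemma generated_step r g : firstCols r g ->
  exists h, Gam h /\ firstCols r.+1 (h * g)%g.
Proof.
move: {2}(height id predT r g) (leqnn (height id predT r g)) => N.
elim/ltn_ind: N g => N IH g leN Cg.
have push i y s : i != y -> (r <= y)%N ->
    (height id predT r (signed s (elem i y) * g)%g < N)%N ->
    exists h, Gam h /\ firstCols r.+1 (h * g)%g.
  move=> iy ry ltN.
  have [] := IH _ ltN _ (leqnn _) (firstCols_x s iy ry Cg) => h [Gh Ch].
  exists (h * signed s (elem i y))%g; split; last by rewrite -mulgA.
  by apply: genM => //; apply: gen_signed; exists i, y; split; rewrite ?itvT.
have [y ry y0] := tail_nonzero Cg.
have [/existsP[i /andP[iy lyi]]|/existsPn none] :=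
  boolP [exists i, (i != y) && (`|SLmx g y r| <= `|SLmx g i r|)].
  have [s lts] := height_descent mM mx (isT : predT i) iy y0 lyi.
  exact: push iy ry (leq_trans lts leN).
have lt_y i : i != y -> `|SLmx g i r| < `|SLmx g y r|.
  by move=> iy; have := none i; rewrite iy /= ltNge.
have [/existsP[i /and3P[iy ri i0]]|/existsPn tail0] :=
  boolP [exists i : 'I_n, [&& i != y, (r <= i)%N & SLmx g i r != 0]].
  have yi : y != i by dneq.
  have [s lts] := height_descent mM mx (isT : predT y) yi i0 (ltW (lt_y i iy)).
  exact: push yi ri (leq_trans lts leN).
have y1 : `|SLmx g y r|%N = 1%N.
  apply: (tail_unit Cg) => k ky rk; apply/eqP.
  by have := tail0 k; rewrite ky rk /= negbK.
have col0 i : i != y -> SLmx g i r = 0 by move=> /lt_y; lia.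
have wG i j : Gam (weyl (@elem n) i j).
  have [<-|ij] := eqVneq i j.
    by rewrite (weyl_id (elem_steinberg n)); apply: gen1.
  by apply: gamma_gen2 (gen2_weyl _ i j); rewrite ?itvT.
have firstCols_w i j h : i != j -> (r <= i)%N -> (r <= j)%N ->
    firstCols r h -> firstCols r (weyl (@elem n) i j * h)%g.
  move=> ij ri rj Ch; have ji : j != i by dneq.
  rewrite weylE -!mulgA; apply: (firstCols_x false) => //.
  by apply: (firstCols_x true) => //; apply: (firstCols_x false).
have [h [Gh Ch h1 h0]] : exists h, [/\ Gam h, firstCols r (h * g)%g,
    `|SLmx (h * g)%g r r|%N = 1%N & forall k, k != r -> SLmx (h * g)%g k r = 0].
  have [yr|yr] := eqVneq y r.
    by rewrite yr in y1 col0; exists 1%g; rewrite mul1g; split=> //; apply: gen1.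
  have ry' : r != y by dneq.
  exists (weyl (@elem n) r y); split=> //; first exact: firstCols_w.
    by rewrite (ent_weylM mM mx) // eqxx.
  move=> k kr; rewrite (ent_weylM mM mx) // (negPf kr).
  by case: eqP => [_|/eqP/col0 //]; rewrite col0 ?oppr0 // eq_sym.
have extend u : firstCols r u -> SLmx u r r = 1 ->
    (forall k, k != r -> SLmx u k r = 0) -> firstCols r.+1 u.
  move=> Cu u1 u0 j; rewrite ltnS leq_eqVlt => /orP[/eqP/val_inj -> k|]; last exact: Cu.
  by have [->|/u0] := eqVneq k r.
have [r1|rN] : SLmx (h * g)%g r r = 1 \/ SLmx (h * g)%g r r = -1 by lia.
  by exists h; split=> //; apply: extend.
have [nr|nr] := eqVneq n r.+1.
  by move: rN; rewrite (last_diag nr Ch).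
(* The sign is changed by the square of the Weyl element for r and r + 1. *)
have zn : (r.+1 < n)%N by move: nr (ltn_ord r); lia.
pose z := Ordinal zn; have rz : r != z by oneq.
have rz' : (r <= z)%N by rewrite /=.
have zr : z != r by dneq.
exists (weyl (@elem n) r z * (weyl (@elem n) r z * h))%g; split.
  exact: genM (wG r z) (genM (wG r z) Gh).
rewrite -!mulgA; apply: extend; first by apply: (firstCols_w) => //; apply:
  (firstCols_w).
  by rewrite !(ent_weylM mM mx) // eqxx (negPf zr) eqxx rN opprK.
move=> k kr; rewrite !(ent_weylM mM mx) // (negPf kr) eqxx.
by case: (eqVneq k z) => _; rewrite h0 ?oppr0.
Qed.

Lemma SL_generated g : Gam g.
Proof.
suff step (k : nat) : (k <= n)%N -> forall g, firstCols (n - k) g -> Gam g.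
  by apply: (step n (leqnn n)) => j; rewrite subnn.
elim: k => [|k IH] kn {}g Cg.
  have -> : g = 1%g; last exact: gen1.
  by apply: SL_ext => i j; rewrite SLmx1 Cg // subn0.
have nk : (n - k.+1 < n)%N by lia.
have [h [Gh Ch]] := @generated_step (Ordinal nk) g Cg.
rewrite -[g](mulKg h); apply: genM; first exact: genV.
by apply: IH; [lia | rewrite (_ : (n - k) = (n - k.+1).+1)%N //; lia].
Qed.

End Generation.

(** * Short words in two generators *)

Section Cycle.
Variables (N : nat) (K : groupType) (x : 'I_N.+1 -> 'I_N.+1 -> K).

(** Indexing by natural numbers avoids successors in ordinal types. *)
Definition nx i j := x (inord i) (inord j).

(** The product w_10 w_21 ... w_(m, m-1), over a signed cycle that sends e_k to
    e_(k+1) for k < m. *)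
Fixpoint coxeter m : K :=
  if m is k.+1 then coxeter k * weyl x (inord k.+1) (inord k) else 1.

Hypothesis S : steinberg x.

Lemma inord_neq i j : i <= N -> j <= N -> i != j ->
  (inord i : 'I_N.+1) != inord j.
Proof.
move=> iN jN ij; apply: contra ij => /eqP/(congr1 val) /=.
by rewrite !inordK // => ->.
Qed.

Lemma weyl_shift i j k l : i != j -> k != l ->
  weyl x i j * x k l =
  signed ((k == i) (+) (l == i)) (x (tperm i j k) (tperm i j l)) * weyl x i j.
Proof.
by move=> ij kl; rewrite -(weyl_conj S ij kl) /conjg invgK mulgA mulgVK.
Qed.

Lemma nx_commutator i j k : i <= N -> j <= N -> k <= N ->
  i != j -> j != k -> i != k ->
  nx i k = nx i j * (nx j k * ((nx i j)^-1 * (nx j k)^-1)).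
Proof. by move=> *; apply: x_commutator => //; apply: inord_neq. Qed.

Lemma coxeter_above m i l : i <= N -> l <= N -> i != l -> m < i -> m < l ->
  coxeter m * nx i l = nx i l * coxeter m.
Proof.
move=> iN lN il; elim: m => [|m IH] mi ml /=; first by rewrite mul1g mulg1.
have mN : m.+1 <= N by lia.
rewrite -mulgA weyl_shift ?inord_neq //; try lia.
rewrite !(negPf (inord_neq _ _ _)) //=; try lia.
by rewrite !tpermD ?inord_neq //; try lia; rewrite mulgA IH ?mulgA //; lia.
Qed.

Lemma coxeter_across m i l : l <= N -> i < m -> m < l ->
  coxeter m * nx i l = nx i.+1 l * coxeter m.
Proof.
move=> lN; elim: m => [|m IH] im ml //=.
have mN : m.+1 <= N by lia.
rewrite -mulgA weyl_shift ?inord_neq //; try lia.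
rewrite !(negPf (inord_neq _ _ _)) //=; try lia.
rewrite (@tpermD _ _ _ (inord l)) ?inord_neq //; try lia.
have [->|i_m] := eqVneq i m.
  by rewrite tpermR mulgA coxeter_above ?mulgA //; lia.
by rewrite tpermD ?inord_neq //; try lia; rewrite mulgA IH ?mulgA //; lia.
Qed.

(** Of the factors, only w_(j+1, j) moves the index j, and then w_(i+1, i)
    moves the index i. *)
Lemma coxeter_shift m i j : m <= N -> i < j -> j < m ->
  coxeter m * nx i j = nx i.+1 j.+1 * coxeter m.
Proof.
move=> + ij; elim: m => [|m IH] mN jm //=.
rewrite -mulgA weyl_shift ?inord_neq //; try lia.
rewrite !(negPf (inord_neq _ _ _)) //=; try lia.
rewrite (@tpermD _ _ _ (inord i)) ?inord_neq //; try lia.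
have [->|j_m] := eqVneq j m.
  by rewrite tpermR mulgA coxeter_across ?mulgA //; lia.
by rewrite tpermD ?inord_neq //; try lia; rewrite mulgA IH ?mulgA //; lia.
Qed.

Lemma coxeter_down m k : k <= N -> m < k ->
  exists s, coxeter m * nx k m = signed s (nx k 0) * coxeter m.
Proof.
move=> kN; elim: m => [|m IH] mk /=; first by exists false; rewrite mul1g mulg1.
have [|s sE] := IH; first by lia.
exists (~~ s); rewrite -mulgA weyl_shift ?inord_neq //; try lia.
rewrite eqxx (negPf (inord_neq _ _ _)) //=; try lia.
rewrite tpermL tpermD ?inord_neq //; try lia.
have -> : coxeter m * ((nx k m)^-1 * weyl x (inord m.+1) (inord m)) =
    (coxeter m * nx k m * (coxeter m)^-1)^-1 * coxeter m * weyl x (inord m.+1)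
      (inord m).
  by rewrite !gnorm.
by rewrite sE mulgK signedV mulgA.
Qed.

(** The last basis vector goes down through all factors. All generators below
    the diagonal are obtained from this one. *)
Lemma coxeter_wrap : 0 < N ->
  exists s, coxeter N * nx N.-1 N = signed s (nx N 0) * coxeter N.
Proof.
move=> N0; have coxeterS m : 0 < m ->
    coxeter m = coxeter m.-1 * weyl x (inord m) (inord m.-1) by case: m.
have [|s sE] := @coxeter_down N.-1 N (leqnn N); first by lia.
exists (~~ s); rewrite (coxeterS N N0) -mulgA weyl_shift ?inord_neq //; try lia.
rewrite eqxx (negPf (inord_neq _ _ _)) //=; try lia.
rewrite tpermL tpermR signedV !mulgA; congr (_ * _).
apply: (mulgI (signed s (nx N 0))); rewrite mulVKg.
by rewrite mulgA -sE mulgK.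
Qed.

Section Length.
(** [short L g] is meant to say that g is a word of length at most L in nx 0 1
    and the Coxeter element. *)
Variable short : nat -> K -> Prop.
Hypothesis short_le : forall L M g, L <= M -> short L g -> short M g.
Hypothesis shortM : forall L M g h, short L g -> short M h -> short (L + M) (g * h).
Hypothesis shortV : forall L g, short L g -> short L g^-1.
Hypothesis short1 : short 0 1.
Hypothesis N2 : 2 <= N.
Hypothesis short_nx01 : short 1 (nx 0 1).
Hypothesis short_coxeter : short 1 (coxeter N).

Lemma coxeter_shiftX h i j : i < j -> j + h <= N ->
  nx (i + h) (j + h) = coxeter N ^+ h * nx i j * coxeter N ^- h.
Proof.
move=> ij; elim: h => [|h IH] jh; first by rewrite !addn0 expg0 invg1 mul1g mulg1.
rewrite !addnS expgS invgM -!mulgA (mulgA (nx i j)) (mulgA (_ ^+ _)).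
rewrite (mulgA (coxeter N ^+ h)) -IH ?mulgA; last by lia.
by rewrite coxeter_shift ?mulgK //; lia.
Qed.

Lemma short_coxeterX h : short h (coxeter N ^+ h).
Proof.
elim: h => [|h IH]; first exact: short1.
by rewrite expgS -add1n; apply: shortM.
Qed.

Lemma short_shift L h i j : i < j -> j + h <= N ->
  short L (nx i j) -> short (L + h.*2) (nx (i + h) (j + h)).
Proof.
move=> ij jh sL; rewrite coxeter_shiftX //.
have -> : (L + h.*2 = (h + L) + h)%N by lia.
apply: shortM; last exact/shortV/short_coxeterX.
by apply: shortM => //; apply: short_coxeterX.
Qed.

Lemma short_commutator L M i j k : i <= N -> j <= N -> k <= N ->
    i != j -> j != k -> i != k ->
  short L (nx i j) -> short M (nx j k) -> short (2 * (L + M))%N (nx i k).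
Proof.
move=> iN jN kN ij jk ik sL sM; rewrite (nx_commutator iN jN kN ij jk ik).
have -> : (2 * (L + M) = L + (M + (L + M)))%N by lia.
by do 3 apply: (shortM) => //; apply: shortV.
Qed.

(** Splitting len into halves h and k, x_(0, len) is the commutator of x_(0, h)
    and x_(h, len), and the latter is x_(0, k) conjugated by the h-th power of
    the Coxeter element. So the length satisfies L(len) <= 2 (L(h) + L(k) + 2
    h), whose solutions are quadratic; the linear term absorbs the odd case. *)
Lemma short_top len : 0 < len -> len <= N ->
  short (5 * len ^ 2 - 4 * len)%N (nx 0 len).
Proof.
elim/ltn_ind: len => len IH len0 lenN.
have [->|len1] := eqVneq len 1%N; first exact: short_nx01.
pose h := len./2; have lenE := odd_double_half len; rewrite -/h in lenE.
have h0 : 0 < h by case: (odd len) lenE; lia.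
pose k := (len - h)%N.
have sh : short (5 * h ^ 2 - 4 * h)%N (nx 0 h) by apply: IH; lia.
have sk : short (5 * k ^ 2 - 4 * k)%N (nx 0 k) by apply: IH; lia.
have kh : (k + h = len)%N by lia.
have := @short_shift _ h 0 k _ _ sk; rewrite add0n kh => {}sk.
apply: (@short_le (2 * ((5 * h ^ 2 - 4 * h) + (5 * k ^ 2 - 4 * k + h.*2)))%N).
  have [kE|kE] : (k = h \/ k = h.+1)%N by case: (odd len) lenE => /=; lia.
    by rewrite -kh kE; nia.
  by rewrite -kh kE; nia.
by apply: (@short_commutator _ _ 0 h len) => //; try lia; apply: sk; lia.
Qed.

Lemma short_upper i j : i < j -> j <= N -> short (7 * N ^ 2)%N (nx i j).
Proof.
move=> ij jN; have -> : nx i j = nx (0 + i) (j - i + i)%N.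
  by rewrite add0n subnK // ltnW.
apply: (@short_le (5 * (j - i) ^ 2 - 4 * (j - i) + i.*2)%N); first by nia.
apply: short_shift; try lia.
by apply: short_top; lia.
Qed.

Lemma short_corner : short (7 * N ^ 2 + 2)%N (nx N 0).
Proof.
have [|s sE] := coxeter_wrap; first by lia.
have s_signed L g : short L g -> short L (signed s g).
  by case: (s) => //=; apply: shortV.
have -> : nx N 0 = signed s (coxeter N * nx N.-1 N * (coxeter N)^-1).
  by rewrite sE mulgK signed_add addbb.
apply: s_signed; have -> : (7 * N ^ 2 + 2 = 1 + 7 * N ^ 2 + 1)%N by lia.
apply: shortM; last exact: shortV.
by apply: shortM => //; apply: short_upper; lia.
Qed.

(** Below the diagonal one passes through the corner: x_ij is obtained from
    x_(i, N), x_(N, 0) and x_(0, j) by commutators. *)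
Lemma short_nx i j : i <= N -> j <= N -> i != j -> short (72 * N ^ 2)%N (nx i j).
Proof.
have col0 k : 0 < k -> k <= N -> short (28 * N ^ 2 + 4)%N (nx k 0).
  move=> k0 kN; have [->|kN'] := eqVneq k N.
    by apply: (short_le _ short_corner); lia.
  apply: (short_le _ (short_commutator _ _ _ _ _ _ (short_upper _ _) short_corner));
    lia.
move=> iN jN ij; have [lij|lji] := ltnP i j.
  by apply: (short_le _ (short_upper lij jN)); lia.
have [->|j0] := eqVneq j 0%N.
  by apply: (short_le _ (col0 i _ _)); [nia | lia | lia].
apply: (short_le _ (short_commutator _ _ _ _ _ _ (col0 i _ _) (short_upper _ _)));
  try lia; nia.
Qed.

End Length.
End Cycle.

(** * Free groups and quotients *)

Section FreeHom.
Variables (X : choiceType) (G : groupType) (phi : X -> G).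

Definition letter (l : X * bool) := signed l.2 (phi l.1).

Definition eval_word (u : seq (X * bool)) : G :=
  foldr (fun l g => letter l * g) 1 u.

Lemma eval_consr l u : eval_word (consr l u) = letter l * eval_word u.
Proof.
case: u => //= k u; case: eqP => [->|_] //=.
by rewrite /letter /= signedV -/(letter l) mulVKg.
Qed.

Lemma eval_cat u v : eval_word (u ++ v) = eval_word u * eval_word v.
Proof. by elim: u => [|l u IH] /=; rewrite ?mul1g // IH mulgA. Qed.

Lemma eval_reduce u : eval_word (reduce u) = eval_word u.
Proof. by elim: u => //= l u IH; rewrite eval_consr IH. Qed.

(** The universal property of the free group. *)
Definition fg_lift (a : freeGroup X) := eval_word (fgword a).

Fact fg_liftM : {morph fg_lift : a b / a * b}.
Proof. by move=> a b; rewrite /fg_lift /= eval_reduce eval_cat. Qed.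

HB.instance Definition _ :=
  isMultiplicative.Build (freeGroup X) G fg_lift fg_liftM.

Fact fg_gen_subproof (y : X) : reduced [:: (y, false)]. Proof. by []. Qed.

Definition fg_gen y := FreeGroup (fg_gen_subproof y).

Lemma fg_lift_gen y : fg_lift (fg_gen y) = phi y.
Proof. by rewrite /fg_lift /= mulg1. Qed.

End FreeHom.

Section FreeLength.
Variable X : choiceType.
Implicit Types a b : freeGroup X.

Lemma size_reduce (u : seq (X * bool)) : size (reduce u) <= size u.
Proof.
elim: u => //= l u IH; apply: leq_trans (_ : (size (reduce u)).+1 <= _) => //.
by case: (reduce u) => //= k v; case: ifP => _ /=; lia.
Qed.

Lemma fglenM a b : fglen (a * b) <= fglen a + fglen b.
Proof. by apply: leq_trans (size_reduce _) _; rewrite size_cat. Qed.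

Lemma fglenV a : fglen a^-1 <= fglen a.
Proof.
by apply: leq_trans (size_reduce _) _; rewrite size_rev size_map.
Qed.

Lemma fg_gen_ind (P : freeGroup X -> Prop) : P 1 ->
    (forall y a, P a -> P (fg_gen y * a)) ->
    (forall y a, P a -> P ((fg_gen y)^-1 * a)) ->
  forall a, P a.
Proof.
move=> P1 PM PV [u ru]; elim: u ru => [|[y b] u IH] ru.
  by rewrite (_ : FreeGroup ru = 1) //; apply: val_inj.
have ru' : reduced u by apply: path_sorted ru.
have -> : FreeGroup ru = signed b (fg_gen y) * FreeGroup ru'.
  apply: val_inj; case: b ru => ru /=; rewrite ?(reduce_id ru') //;
    by rewrite -[LHS](reduce_id ru) /= (reduce_id ru').
by case: b {ru} => /=; [apply: PV | apply: PM]; apply: IH.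
Qed.

End FreeLength.

(** The normal subgroup is a predicate in Prop, which excluded middle turns
    into a boolean equivalence relation. *)
Section Quotient.
Local Open Scope quotient_scope.
Variables (G : groupType) (N : G -> Prop).
Hypothesis nN : normal_subgroup N.

Definition coset_rel (g h : G) : bool := `[< N (g^-1 * h) >].

Lemma coset_rel_equiv : equiv_class_of coset_rel.
Proof.
case: nN => N1 NM NV NJ; split=> [g|g h|h g k].
- by apply/asboolP; rewrite mulVg.
- by apply/asboolP/asboolP => /NV; rewrite invgM invgK.
- move=> /asboolP Ngh /asboolP Nhk; apply/asboolP.
  by have := NM _ _ Ngh Nhk; rewrite mulgA mulgK.
Qed.

Canonical coset_equiv := EquivRelPack coset_rel_equiv.

Definition quot := {eq_quot coset_equiv}.
HB.instance Definition _ := Choice.on quot.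
HB.instance Definition _ := EqQuotient.on quot.

Definition proj (g : G) : quot := \pi g.

Lemma proj_eq g h : proj g = proj h <-> N (g^-1 * h).
Proof.
split; first by move=> /eqmodP /asboolP.
by move=> Ngh; apply/eqmodP/asboolP.
Qed.

Lemma projK (q : quot) : proj (repr q) = q. Proof. exact: reprK. Qed.

Definition quot_mul (q r : quot) : quot := proj (repr q * repr r).
Definition quot_inv (q : quot) : quot := proj (repr q)^-1.

Lemma quot_mulE g h : quot_mul (proj g) (proj h) = proj (g * h).
Proof.
case: nN => N1 NM NV NJ; apply/proj_eq.
have /proj_eq Ng := projK (proj g); have /proj_eq Nh := projK (proj h).
rewrite invgM; set g' := repr (proj g); set h' := repr (proj h).
have -> : h'^-1 / g' * (g * h) = (g'^-1 * g) ^ h' * (h'^-1 * h).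
  by rewrite /conjg -!mulgA mulVKg.
by apply: NM => //; apply: NJ.
Qed.

Lemma quot_invE g : quot_inv (proj g) = proj g^-1.
Proof.
case: nN => N1 NM NV NJ; apply/proj_eq.
have /proj_eq := projK (proj g); set g' := repr (proj g) => Ng.
have -> : (g'^-1)^-1 / g = ((g'^-1 * g)^-1) ^ g'^-1.
  by rewrite /conjg !gnorm.
by apply: NJ; apply: NV.
Qed.

Fact quot_mulA : associative quot_mul.
Proof. by move=> p q r; rewrite -(projK p) -(projK q) -(projK r) !quot_mulE mulgA. Qed.
Fact quot_mul1g : left_id (proj 1) quot_mul.
Proof. by move=> q; rewrite -(projK q) quot_mulE mul1g. Qed.
Fact quot_mulg1 : right_id (proj 1) quot_mul.
Proof. by move=> q; rewrite -(projK q) quot_mulE mulg1. Qed.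
Fact quot_mulVg : left_inverse (proj 1) quot_inv quot_mul.
Proof. by move=> q; rewrite -(projK q) quot_invE quot_mulE mulVg. Qed.
Fact quot_mulgV : right_inverse (proj 1) quot_inv quot_mul.
Proof. by move=> q; rewrite -(projK q) quot_invE quot_mulE mulgV. Qed.

HB.instance Definition _ :=
  isGroup.Build quot quot_mulA quot_mul1g quot_mulg1 quot_mulVg quot_mulgV.

Lemma projM : {morph proj : g h / g * h}.
Proof. by move=> g h; rewrite -quot_mulE. Qed.

Lemma proj1 g : proj g = 1 <-> N g.
Proof.
case: nN => N1 NM NV NJ; split.
  by move=> /proj_eq; rewrite mulg1 => /NV; rewrite invgK.
by move=> Ng; apply/proj_eq; rewrite mulg1; apply: NV.
Qed.

End Quotient.

(** * The presentation *)

Section Relators.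
Variables (n : nat) (G : groupType) (W : 'I_n -> 'I_n -> G).

(** All kinds of relators are indexed by quadruples, some of them repeatedly;
    this keeps the count simple and costs a constant factor only. *)
Definition steinberg_relator (t : 'I_n * 'I_n * 'I_n * 'I_n) (c : nat) : G :=
  let: (i, j, k, l) := t in
  match c with
  | 0 => if [&& i != j, k != l, j != k & i != l]
         then (W i j * W k l) / (W k l * W i j) else 1
  | 1 => if [&& i != j, j != k & i != k]
         then (W i j * W j k) / (W i k * (W j k * W i j)) else 1
  | 2 => if i != j then (W i j * ((W j i)^-1 * W i j)) /
                        ((W j i)^-1 * (W i j * (W j i)^-1)) else 1
  | _ => if i != j then (W i j * ((W j i)^-1 * W i j)) ^+ 4 else 1
  end.

Definition steinberg_relators : seq G :=
  [seq steinberg_relator t c |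
     t <- enum {: 'I_n * 'I_n * 'I_n * 'I_n}, c <- iota 0 4].

Lemma size_steinberg_relators : (size steinberg_relators = 4 * n ^ 4)%N.
Proof.
by rewrite size_allpairs -cardE !card_prod card_ord size_iota; lia.
Qed.

Lemma steinberg_relatorsP (H : groupType) (p : G -> H) :
  {morph p : u v / u * v} ->
  (forall i, p (W i i) = 1) ->
  (forall u, u \in steinberg_relators -> p u = 1) <->
  steinberg (fun i j => p (W i j)).
Proof.
move=> pM W1; have pF u v : p (u / v) = 1 <-> p u = p v.
  rewrite pM (morph_inv pM); split=> [/divg1_eq//|->]; exact: mulgV.
split=> [rels1|St].
  have rel t (c : nat) : c \in iota 0 4 -> p (steinberg_relator t c) = 1.
    by move=> c4; apply: rels1; apply: allpairs_f => //; rewrite mem_enum.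
  split=> [//|i j k l ij kl jk il|i j k ij jk ik|i j ij|i j ij].
  - have := rel (i, j, k, l) 0%N isT; rewrite /= ij kl jk il /= => /pF.
    by rewrite !pM.
  - have := rel (i, j, k, k) 1%N isT; rewrite /= ij jk ik /= => /pF.
    by rewrite !pM.
  - have := rel (i, j, i, j) 2%N isT; rewrite /= ij /= => /pF.
    by rewrite !pM !(morph_inv pM).
  - have := rel (i, j, i, j) 3%N isT; rewrite /= ij /=.
    by rewrite (morph_exp pM) !pM !(morph_inv pM).
move=> u /allpairsP[[[[[i j] k] l] c] /= [_ c4 ->]].
case: c c4 => [_|[_|[_|[_|c]]]] //=; case: ifP => //; rewrite ?(morph_one pM) //.
- by case/and4P=> ij kl jk il; apply/pF; rewrite !pM; apply: (st_comm St).
- by case/and3P=> ij jk ik; apply/pF; rewrite !pM; apply: (st_chain St).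
- by move=> ij; apply/pF; rewrite !pM !(morph_inv pM); apply: (st_braid St).
- by move=> ij; rewrite (morph_exp pM) !pM !(morph_inv pM); apply: (st_order St).
Qed.

End Relators.

Lemma coxeter_morph N (G H : groupType) (p : G -> H)
    (W : 'I_N.+1 -> 'I_N.+1 -> G) k : {morph p : u v / u * v} ->
  p (coxeter W k) = coxeter (fun i j => p (W i j)) k.
Proof.
move=> pM; elim: k => [|k IH] /=; first by rewrite (morph_one pM).
by rewrite pM IH !weylE !pM (morph_inv pM).
Qed.

Lemma gamma_coxeter N (K : groupType) (x : 'I_N.+1 -> 'I_N.+1 -> K) k :
  k <= N -> gamma x (itv _ 0 N.+1) (coxeter x k).
Proof.
elim: k => [|k IH] kN; first exact: gen1.
apply: genM; first by apply: IH; lia.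
apply: gamma_gen2 (gen2_weyl _ _ _); rewrite /= ?ltn_ord //.
by apply: inord_neq; lia.
Qed.

Lemma normal_closure_normal (G : groupType) (S : seq G) :
  normal_subgroup (normal_closure S).
Proof.
split=> [N [N1 NM NV NJ] NS|u v Nu Nv N nN NS|u Nu N nN NS|u v Nu N nN NS] //.
- by case: (nN) => _ NM _ _; apply: NM; [apply: Nu | apply: Nv].
- by case: (nN) => _ _ NV _; apply: NV; apply: Nu.
- by case: (nN) => _ _ _ NJ; apply: NJ; apply: Nu.
Qed.

Lemma fglenM_le (X : choiceType) (u v : freeGroup X) p q :
  fglen u <= p -> fglen v <= q -> fglen (u * v) <= p + q.
Proof. by move=> up vq; apply: leq_trans (fglenM _ _) (leq_add up vq). Qed.

Lemma fglenV_le (X : choiceType) (u : freeGroup X) p :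
  fglen u <= p -> fglen u^-1 <= p.
Proof. by apply: leq_trans; apply: fglenV. Qed.

(** The outcome of Tietze transformations that eliminate the generators e_ij by
    means of the words W i j in the generators a and b. *)
Definition two_gen_relators N (W : 'I_N.+1 -> 'I_N.+1 -> freeGroup 'I_2) :
    seq (freeGroup 'I_2) :=
  (fg_gen ord0)^-1 * nx W 0 1 ::
  (fg_gen ord_max)^-1 * coxeter W N :: steinberg_relators W.

Section Transfer.
Variables (N : nat) (phi : 'I_2 -> SL N.+1 int).
Local Notation F := (fg_lift phi).
Variable W : 'I_N.+1 -> 'I_N.+1 -> freeGroup 'I_2.
Hypothesis N2 : 2 <= N.
Hypothesis W1 : forall i, W i i = 1.
Hypothesis FW : forall i j, F (W i j) = elem i j.
Let a : 'I_2 := ord0.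
Let b : 'I_2 := ord_max.
Hypothesis phi_a : phi a = nx (@elem N.+1) 0 1.
Hypothesis phi_b : phi b = coxeter (@elem N.+1) N.

Let FM := fg_liftM phi.

Let FWE : (fun i j => F (W i j)) = @elem N.+1.
Proof. by apply/funext => i; apply/funext => j. Qed.

(** In the quotient of the free group by the normal closure of the relators,
    the classes of the words W i j satisfy Steinberg's relations, lie over the
    e_ij and generate, because the first two relators express a and b by them.
    So the map from the quotient to the matrices is injective, by
    [gamma_itv_inj]. *)
Lemma two_gen_presents : presents (two_gen_relators W) F.
Proof.
have Frels r : r \in two_gen_relators W -> F r = 1.
  rewrite !inE => /or3P[/eqP->|/eqP->|].
  - by rewrite FM (morph_inv FM) fg_lift_gen phi_a /nx FW mulVg.
  - by rewrite FM (morph_inv FM) fg_lift_gen phi_b (coxeter_morph _ _ FM) FWE mulVg.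
  - apply: (steinberg_relatorsP FM _).2 => [i|]; first by rewrite W1 (morph_one FM).
    by rewrite FWE; apply: elem_steinberg.
have kerF w : normal_closure (two_gen_relators W) w -> F w = 1.
  move=> /(_ (fun v => F v = 1)); apply=> //; split=> [|u v|u|u v] /=; first exact:
    (morph_one FM).
  - by rewrite FM => -> ->; rewrite mulg1.
  - by rewrite (morph_inv FM) => ->; rewrite invg1.
  - by rewrite /conjg !FM (morph_inv FM) => ->; rewrite mul1g mulVg.
have surjF g : exists w, F w = g.
  elim: (SL_generated g) => [|_ {}g [i [j [_ _ ij ->]]] _ [w <-]
                           |_ {}g [i [j [_ _ ij ->]]] _ [w <-]].
  - by exists 1; apply: (morph_one FM).
  - by exists (W i j * w); rewrite FM FW.
  - by exists ((W i j)^-1 * w); rewrite FM (morph_inv FM) FW.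
split=> [//|w]; split=> [Fw|]; last exact: kerF.
have nN := normal_closure_normal (two_gen_relators W).
pose x i j := proj nN (W i j).
have pM := projM nN.
have St : steinberg x.
  apply: (steinberg_relatorsP pM _).1 => [i|r rr]; first by rewrite W1 (morph_one pM).
  by apply/proj1 => M nM; apply; rewrite !inE rr !orbT.
pose m (q : quot nN) := F (repr q).
have mE u : m (proj nN u) = F u.
  have /proj_eq/kerF := projK (proj nN u).
  by rewrite FM (morph_inv FM) => /mulg1_eq; rewrite invgK.
have mM : {morph m : q r / q * r}.
  by move=> q r; rewrite -(projK q) -(projK r) -pM !mE FM.
have mx i j : m (x i j) = elem i j by rewrite mE FW.
apply/(proj1 nN); apply: (gamma_itv_inj St mM mx (lo := 0)); last by rewrite mE.
have gamma_gen y : gamma x (itv N.+1 0 N.+1) (proj nN (fg_gen y)).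
  have [->|->] : y = a \/ y = b.
    by case: y => -[|[|//]] i; [left | right]; apply: val_inj.
  - have -> : proj nN (fg_gen a) = nx x 0 1.
      by apply/proj_eq => M nM; apply; rewrite !inE eqxx.
    by apply: gen_sub; exists (inord 0), (inord 1); split=> //;
      rewrite /= ?ltn_ord //; apply: inord_neq; lia.
  - have -> : proj nN (fg_gen b) = coxeter x N.
      rewrite -(coxeter_morph W N pM); apply/proj_eq => M nM; apply.
      by rewrite !inE eqxx orbT.
    exact: gamma_coxeter.
elim/fg_gen_ind: w {Fw} => [|y u IH|y u IH].
- by rewrite (morph_one pM); apply: gen1.
- by rewrite pM; apply: genM (gamma_gen y) IH.
- by rewrite pM (morph_inv pM); apply: genM (genV (gamma_gen y)) IH.
Qed.

End Transfer.

Section RelatorLength.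
Variables (N L : nat) (W : 'I_N.+1 -> 'I_N.+1 -> freeGroup 'I_2).
Hypothesis LW : forall i j, fglen (W i j) <= L.

Lemma fglen_relator t c : fglen (steinberg_relator W t c) <= 12 * L.
Proof.
case: t => [[[i j] k] l]; case: c => [|[|[|c]]] /=; case: ifP => // _.
- apply: leq_trans (_ : (L + L) + (L + L) <= _)%N; last lia.
  by apply: fglenM_le; [|apply: fglenV_le]; apply: fglenM_le.
- apply: leq_trans (_ : (L + L) + (L + (L + L)) <= _)%N; last lia.
  by apply: fglenM_le; [|apply: fglenV_le; apply: fglenM_le => //]; apply: fglenM_le.
- apply: leq_trans (_ : (L + (L + L)) + (L + (L + L)) <= _)%N; last lia.
  apply: fglenM_le; [|apply: fglenV_le]; apply: fglenM_le => //; try exact: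
    fglenV_le; apply: fglenM_le => //; exact: fglenV_le.
- have w3 : fglen (W i j * ((W j i)^-1 * W i j)) <= L + (L + L).
    by apply: fglenM_le => //; apply: fglenM_le => //; apply: fglenV_le.
  rewrite !expgS expg0 mulg1; 
  have -> : (12 * L = 3 * L + (3 * L + (3 * L + 3 * L)))%N by lia.
  have {}w3 : fglen (W i j * ((W j i)^-1 * W i j)) <= 3 * L by lia.
  by do 2 (apply: fglenM_le => //); apply: fglenM_le.
Qed.

Lemma fglen_coxeter k : fglen (coxeter W k) <= k * (3 * L).
Proof.
elim: k => [|k IH] //=; apply: leq_trans (fglenM _ _) _; rewrite weylE.
rewrite mulSn addnC; apply: leq_add => //.
apply: leq_trans (fglenM _ _) _; rewrite !mulSn mul0n addn0.
apply: leq_add => //; apply: leq_trans (fglenM _ _) (leq_add _ _) => //.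
exact: leq_trans (fglenV _) _.
Qed.

Lemma total_length_bound (s : seq (freeGroup 'I_2)) M :
  (forall u, u \in s -> fglen u <= M) -> total_relator_length s <= size s * M.
Proof.
move=> sM; rewrite /total_relator_length -sum1_size big_distrl /=.
by rewrite big_seq [leqRHS]big_seq; apply: leq_sum => u us; rewrite mul1n sM.
Qed.

Lemma two_gen_total_length :
  total_relator_length (two_gen_relators W) <=
  (1 + L) + (1 + N * (3 * L)) + 4 * N.+1 ^ 4 * (12 * L).
Proof.
have gen_inv y u : fglen ((fg_gen y)^-1 * u : freeGroup 'I_2) <= 1 + fglen u.
  by apply: leq_trans (fglenM _ _) (leq_add (fglenV _) _).
rewrite /total_relator_length /two_gen_relators !big_cons -addnA.
apply: leq_add; first by apply: leq_trans (gen_inv _ _) _; rewrite leq_add2l LW.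
apply: leq_add.
  by apply: leq_trans (gen_inv _ _) _; rewrite leq_add2l fglen_coxeter.
rewrite -(size_steinberg_relators W); apply: total_length_bound => u.
by case/allpairsP=> -[t c] [_ _ ->]; apply: fglen_relator.
Qed.

End RelatorLength.

(** The diagonal words have to be trivial, as required by the convention x_ii =
    1. *)
Lemma short_elem_words N : 2 <= N -> exists (phi : 'I_2 -> SL N.+1 int)
    (W : 'I_N.+1 -> 'I_N.+1 -> freeGroup 'I_2),
  [/\ phi ord0 = nx (@elem N.+1) 0 1, phi ord_max = coxeter (@elem N.+1) N,
      forall i, W i i = 1, forall i j, fg_lift phi (W i j) = elem i j &
      forall i j, fglen (W i j) <= 72 * N ^ 2].
Proof.
move=> N2.
pose phi (i : 'I_2) := if i == ord0 then nx (@elem N.+1) 0 1 else coxeter (@elem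
  N.+1) N.
have FM := fg_liftM phi.
pose short L g := exists2 u, fg_lift phi u = g & fglen u <= L.
have shortS L g : 0 < L -> (exists y, phi y = g) -> short L g.
  by move=> L0 [y <-]; exists (fg_gen y); rewrite ?fg_lift_gen.
have short_ex i j : exists u, [/\ fg_lift phi u = elem i j,
    fglen u <= 72 * N ^ 2 & i == j -> u = 1].
  have [->|ij] := eqVneq i j.
    by exists 1; rewrite elemii (morph_one FM).
  suff [u uE ul] : short (72 * N ^ 2)%N (nx (@elem N.+1) i j).
    by exists u; rewrite uE /nx !inord_val.
  have iN : i <= N by rewrite -ltnS.
  have jN : j <= N by rewrite -ltnS.
  apply: (short_nx (elem_steinberg N.+1) (short := short)) => //.
  - by move=> L M g LM [u uE ul]; exists u => //; apply: leq_trans LM.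
  - move=> L M g h [u uE ul] [v vE vl]; exists (u * v); first by rewrite FM uE vE.
    exact: fglenM_le.
  - move=> L g [u uE ul]; exists u^-1; first by rewrite (morph_inv FM) uE.
    exact: fglenV_le.
  - by exists 1; rewrite ?(morph_one FM).
  - by apply: shortS => //; exists ord0.
  - by apply: shortS => //; exists ord_max.
have [W WP] := choice (fun ij : 'I_N.+1 * 'I_N.+1 => short_ex ij.1 ij.2).
exists phi, (fun i j => W (i, j)); split=> //.
- by move=> i; case: (WP (i, i)) => _ _; apply; apply: eqxx.
- by move=> i j; case: (WP (i, j)).
- by move=> i j; case: (WP (i, j)).
Qed.

Local Open Scope ring_scope.

Theorem corollary3p7 (R : realType) :
  exists C3 C4 : R,
    [/\ 0 < C3, 0 < C4 &
      forall n : nat, (3 <= n)%N ->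
        exists rels : seq (freeGroup 'I_2),
          [/\ has_presentation rels (SL n int),
              (size rels)%:R <= C3 * n%:R ^+ 4 &
              (total_relator_length rels)%:R <= C4 * n%:R ^+ 6]].
Proof.
(* There are 4 n^4 + 2 relators. The Steinberg relators have length at most 12
   times 72 n^2, and 4 * 12 * 72 = 3456 leaves room for the other two. *)
exists 5, 4000; split=> // -[//|N] N2.
have [phi [W [phi_a phi_b W1 FW LW]]] := short_elem_words N2.
exists (two_gen_relators W); split.
- by eexists; apply: (two_gen_presents N2 W1 FW phi_a phi_b).
- rewrite -natrX -natrM ler_nat /= size_steinberg_relators.
  have : (2 ^ 4 <= N.+1 ^ 4)%N by rewrite leq_exp2r //; lia.
  by move: (N.+1 ^ 4)%N => q; lia.
- rewrite -natrX -natrM ler_nat; apply: leq_trans (two_gen_total_length LW) _.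
  have -> : (N.+1 ^ 4 = N.+1 ^ 2 * N.+1 ^ 2)%N by rewrite -expnD.
  have -> : (N.+1 ^ 6 = N.+1 ^ 2 * N.+1 ^ 2 * N.+1 ^ 2)%N by rewrite -!expnD.
  have NN : (N ^ 2 <= N.+1 ^ 2)%N by rewrite leq_exp2r.
  have Nle : (N <= N.+1 ^ 2)%N by rewrite -[leqLHS]expn1; nia.
  move: (N.+1 ^ 2)%N (N ^ 2)%N NN Nle => q p pq Nq.
  have q1 : (1 <= q)%N by lia.
  have cubic : (q * q * p <= q * q * q)%N by rewrite leq_mul2l pq orbT.
  have quadratic : (N * p <= q * q)%N by apply: leq_mul.
  have : (q * q <= q * q * q)%N by rewrite leq_pmulr.
  have : (q <= q * q)%N by rewrite leq_pmulr.
  lia.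
Qed.
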